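(* Let $|\psi_1\rangle,|\psi_2\rangle$ be unknown pure states of the same dimension, and suppose it is promised that $\Delta:=\arccos|\langle\psi_1|\psi_2\rangle|$ is known and $\Delta\notin\{0,\pi/2\}$. Let $e^{i\varphi}:=\langle\psi_2|\psi_1\rangle/|\langle\psi_2|\psi_1\rangle|$ and, for $\chi\in\mathbb{R}$, $$|\psi(\chi)\rangle:=\frac{1}{\sin\Delta}\Big(\sin(\Delta-\chi)|\psi_1\rangle+e^{i\varphi}\sin\chi\,|\psi_2\rangle\Big).$$ Then a state within trace distance $\delta$ of $|\psi(\chi)\rangle\langle\psi(\chi)|$ can be produced using $O\!\left(\frac{\chi^2}{\delta\sin^2 2\Delta}\right)$ copies of $|\psi_1\rangle$ and of $|\psi_2\rangle$.
   Context: The trace distance between states $\rho,\sigma$ is $\tfrac12\|\rho-\sigma\|_1$ with $\|A\|_1=\operatorname{Tr}\sqrt{AA^\dagger}$.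
   Formalization: The number of copies is bounded by K(1 + χ²/(δ sin² 2Δ)) with a universal constant K; the added 1 is needed because, for example at χ = 0, the literal bound would allow no copies although the unknown state |ψ₁⟩ must be produced. *)

(* Defs.v *)
From Stdlib Require Import Reals List.
Import ListNotations.
Open Scope R_scope.

Record C := mkC { re : R ; im : R }.
Definition C0 : C := mkC 0 0.
Definition C1 : C := mkC 1 0.
Definition RtoC (r : R) : C := mkC r 0.
Definition Cadd (a b : C) : C := mkC (re a + re b) (im a + im b).
Definition Copp (a : C) : C := mkC (- re a) (- im a).
Definition Csub (a b : C) : C := Cadd a (Copp b).
Definition Cmul (a b : C) : C :=
  mkC (re a * re b - im a * im b) (re a * im b + im a * re b).
Definition Cconj (a : C) : C := mkC (re a) (- im a).
Definition Cmod (a : C) : R := sqrt (re a * re a + im a * im a).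
Definition Cscale (r : R) (a : C) : C := mkC (r * re a) (r * im a).

Fixpoint Csum (n : nat) (f : nat -> C) : C :=
  match n with
  | O => C0
  | S k => Cadd (Csum k f) (f k)
  end.

(** * Vectors and matrices (entries outside the stated dimensions are irrelevant) *)
Definition Vec := nat -> C.
Definition Mat := nat -> nat -> C.

Definition inner (d : nat) (u v : Vec) : C :=
  Csum d (fun i => Cmul (Cconj (u i)) (v i)).

Definition unit_vec (d : nat) (u : Vec) : Prop := inner d u u = C1.

(** Kronecker product of u in C^du with v in C^dv (dimension du*dv) *)
Definition vtens (dv : nat) (u v : Vec) : Vec :=
  fun i => Cmul (u (i / dv)%nat) (v (i mod dv)%nat).

Fixpoint vpow (d n : nat) (u : Vec) : Vec :=
  match n with
  | O => fun _ => C1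
  | S k => vtens (d ^ k)%nat u (vpow d k u)
  end.

Definition proj (v : Vec) : Mat := fun i j => Cmul (v i) (Cconj (v j)).

Definition mmul (k : nat) (A B : Mat) : Mat :=
  fun i j => Csum k (fun l => Cmul (A i l) (B l j)).
Definition adj (A : Mat) : Mat := fun i j => Cconj (A j i).
Definition msub (A B : Mat) : Mat := fun i j => Csub (A i j) (B i j).
Definition madd (A B : Mat) : Mat := fun i j => Cadd (A i j) (B i j).
Definition mzero : Mat := fun _ _ => C0.
Definition mid : Mat := fun i j => if Nat.eqb i j then C1 else C0.
Definition trace (n : nat) (A : Mat) : C := Csum n (fun i => A i i).

Definition meq (m n : nat) (A B : Mat) : Prop :=
  forall i j, (i < m)%nat -> (j < n)%nat -> A i j = B i j.

Definition psd (n : nat) (B : Mat) : Prop :=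
  (forall i j, (i < n)%nat -> (j < n)%nat -> B i j = Cconj (B j i)) /\
  (forall v : Vec,
     0 <= re (Csum n (fun i => Csum n (fun j =>
                Cmul (Cconj (v i)) (Cmul (B i j) (v j)))))).

(** [t] is the trace norm ||A||_1 = Tr sqrt(A A^dagger) of the n x n matrix A:
    sqrt(A A^dagger) is the (unique) psd matrix B with B B = A A^dagger. *)
Definition is_trace_norm (n : nat) (A : Mat) (t : R) : Prop :=
  exists B : Mat, psd n B /\ meq n n (mmul n B B) (mmul n A (adj A)) /\
                  t = re (trace n B).

Definition trace_dist_le (n : nat) (rho sigma : Mat) (delta : R) : Prop :=
  exists t, is_trace_norm n (msub rho sigma) t /\ t / 2 <= delta.

Definition kraus_apply (din : nat) (Ks : list Mat) (rho : Mat) : Mat :=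
  fold_right (fun K acc => madd (mmul din (mmul din K rho) (adj K)) acc) mzero Ks.

Definition kraus_TP (din dout : nat) (Ks : list Mat) : Prop :=
  meq din din
    (fold_right (fun K acc => madd (mmul dout (adj K) K) acc) mzero Ks) mid.

Definition phase (d : nat) (psi1 psi2 : Vec) : C :=
  Cscale (/ Cmod (inner d psi2 psi1)) (inner d psi2 psi1).

Definition psi_chi (d : nat) (Delta chi : R) (psi1 psi2 : Vec) : Vec :=
  fun i => Cscale (/ sin Delta)
             (Cadd (Cscale (sin (Delta - chi)) (psi1 i))
                   (Cmul (phase d psi1 psi2) (Cscale (sin chi) (psi2 i)))).

Definition copies (d n1 n2 : nat) (psi1 psi2 : Vec) : Vec :=
  vtens (d ^ n2)%nat (vpow d n1 psi1) (vpow d n2 psi2).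

(* Main.v *)
From Stdlib Require Import Reals List Lra Lia Arith ZArith.
Require Import Defs.
Import ListNotations.
Open Scope R_scope.

(** Let [c] be the cyclic permutation of three copies of [C^d], mapping [x ⊗ u ⊗ w] to
    [u ⊗ w ⊗ x].  Applying the unitary [a + b c + g c^2], with real coefficients and
    [b ≈ - g ≈ 2t], to [σ ⊗ |psi1><psi1| ⊗ |psi2><psi2|] and discarding the last two factors
    gives [σ + 2t [[|psi1><psi1|, |psi2><psi2|], σ] + O(t^2)]: an infinitesimal rotation in
    the plane of [psi1] and [psi2], by an angle [- t sin (2 Delta)].  Starting from [psi1], [N]
    such steps with [t = - chi / (N sin (2 Delta))] reach [psi(chi)] with error
    [O(N t^2) = O(chi^2 / (N sin^2 (2 Delta)))].  The state never leaves the plane, where it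
    is a real symmetric 2x2 matrix of trace 1; the difference of two such matrices squares
    to a scalar, which makes the trace norm explicit. *)

(** * Complex arithmetic and finite sums *)

(** Why a 3-cycle: a partial swap of [σ] with one projector [ρ] generates [i [ρ, σ]], which drives a
    real state out of the real plane. The cycle yields the product of both projectors, and
    [c - c^2], anti-Hermitian because [c^2] is the inverse of [c], yields the commutator [[ρ1, ρ2]],
    which is [cos Delta * sin Delta] times the generator of real rotations of the plane. The unitary
    depends on the states only through the known [Delta], so one Kraus list serves every pair with
    that angle. The phase of the overlap never has to be known: only the projector on [psi2] enters,
    and a suitable phase multiple of [psi2] has the real coordinates [(cos Delta, sin Delta)]. The
    estimates take place on a Bloch disc: a state is the point [(p - 1/2, q)], trace distance is
    Euclidean distance, and [psi(chi)] lies at radius 1/2 and angle [2 chi]. Rotations are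
    isometries, so the errors of successive steps merely add. The summand 1 in the count covers the
    initial copy of [psi1] and the rounding of [N]. *)

Lemma C_eq (x y : C) : re x = re y -> im x = im y -> x = y.
Proof. destruct x, y; simpl; intros; subst; reflexivity. Qed.

Lemma C_ring_theory : ring_theory C0 C1 Cadd Cmul Csub Copp eq.
Proof.
  constructor; intros; try reflexivity; apply C_eq; simpl; ring.
Qed.
Add Ring C_ring : C_ring_theory.

Lemma Cconj_add x y : Cconj (Cadd x y) = Cadd (Cconj x) (Cconj y).
Proof. apply C_eq; simpl; ring. Qed.

Lemma Cconj_mul x y : Cconj (Cmul x y) = Cmul (Cconj x) (Cconj y).
Proof. apply C_eq; simpl; ring. Qed.

Lemma Cconj_conj x : Cconj (Cconj x) = x.
Proof. apply C_eq; simpl; ring. Qed.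

Lemma Cconj_RtoC r : Cconj (RtoC r) = RtoC r.
Proof. apply C_eq; simpl; ring. Qed.

Lemma Cconj_0 : Cconj C0 = C0.
Proof. apply C_eq; simpl; ring. Qed.

Lemma RtoC_add x y : RtoC (x + y) = Cadd (RtoC x) (RtoC y).
Proof. apply C_eq; simpl; ring. Qed.

Lemma RtoC_mul x y : RtoC (x * y) = Cmul (RtoC x) (RtoC y).
Proof. apply C_eq; simpl; ring. Qed.

Lemma Cscale_RtoC r x : Cscale r x = Cmul (RtoC r) x.
Proof. apply C_eq; simpl; ring. Qed.

Lemma Csum_ext n f g :
  (forall i, (i < n)%nat -> f i = g i) -> Csum n f = Csum n g.
Proof.
  induction n as [|n IH]; simpl; intros H; [reflexivity|].
  rewrite IH by (intros; apply H; lia). rewrite H by lia. reflexivity.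
Qed.

Lemma Csum_zero n : Csum n (fun _ => C0) = C0.
Proof. induction n as [|n IH]; simpl; [|rewrite IH]; ring. Qed.

Lemma Csum_add n f g :
  Csum n (fun i => Cadd (f i) (g i)) = Cadd (Csum n f) (Csum n g).
Proof. induction n as [|n IH]; simpl; [|rewrite IH]; ring. Qed.

Lemma Csum_mul_l n c f : Csum n (fun i => Cmul c (f i)) = Cmul c (Csum n f).
Proof. induction n as [|n IH]; simpl; [|rewrite IH]; ring. Qed.

Lemma Csum_mul_r n c f : Csum n (fun i => Cmul (f i) c) = Cmul (Csum n f) c.
Proof. induction n as [|n IH]; simpl; [|rewrite IH]; ring. Qed.

Lemma Csum_conj n f : Cconj (Csum n f) = Csum n (fun i => Cconj (f i)).
Proof.
  induction n as [|n IH]; simpl; [apply Cconj_0|].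
  rewrite Cconj_add, IH; reflexivity.
Qed.

Lemma Csum_swap m n (f : nat -> nat -> C) :
  Csum m (fun i => Csum n (fun j => f i j)) =
  Csum n (fun j => Csum m (fun i => f i j)).
Proof.
  induction m as [|m IH]; simpl; [symmetry; apply Csum_zero|].
  rewrite IH, <- Csum_add. reflexivity.
Qed.

Lemma Csum_app m n f :
  Csum (m + n) f = Cadd (Csum m f) (Csum n (fun i => f (m + i)%nat)).
Proof.
  induction n as [|n IH]; [rewrite Nat.add_0_r; simpl; ring|].
  rewrite Nat.add_succ_r; simpl; rewrite IH; ring.
Qed.

Lemma Csum_divmod m n f :
  Csum (m * n) f = Csum m (fun i => Csum n (fun j => f (i * n + j)%nat)).
Proof.
  induction m as [|m IH]; [reflexivity|].
  replace (S m * n)%nat with (m * n + n)%nat by lia.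
  rewrite Csum_app, IH. reflexivity.
Qed.

Lemma mid_neq i j : i <> j -> mid i j = C0.
Proof. intros H; unfold mid; apply Nat.eqb_neq in H; rewrite H; reflexivity. Qed.

Lemma mid_refl i : mid i i = C1.
Proof. unfold mid; rewrite Nat.eqb_refl; reflexivity. Qed.

Lemma mid_sym i j : mid i j = mid j i.
Proof. unfold mid; rewrite Nat.eqb_sym; reflexivity. Qed.

Lemma Cconj_mid i j : Cconj (mid i j) = mid i j.
Proof. unfold mid; destruct (Nat.eqb i j); apply C_eq; simpl; ring. Qed.

Lemma Csum_mid_r n p f :
  (p < n)%nat -> Csum n (fun j => Cmul (mid j p) (f j)) = f p.
Proof.
  induction n as [|n IH]; [lia|]; intros Hp; simpl.
  destruct (Nat.eq_dec p n) as [->|Hne].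
  - rewrite mid_refl, (Csum_ext n _ (fun _ => C0)), Csum_zero; [ring|].
    intros i Hi; rewrite mid_neq by lia; ring.
  - rewrite IH, mid_neq by lia; ring.
Qed.

Lemma Csum_mid_l n p f :
  (p < n)%nat -> Csum n (fun j => Cmul (mid p j) (f j)) = f p.
Proof.
  intros Hp. rewrite <- (Csum_mid_r n p f Hp).
  apply Csum_ext; intros; now rewrite mid_sym.
Qed.

Lemma Csum2_mid d p q (f : nat -> nat -> C) :
  (p < d)%nat -> (q < d)%nat ->
  Csum d (fun j => Csum d (fun k =>
    Cmul (Cmul (mid p j) (mid q k)) (f j k))) = f p q.
Proof.
  intros Hp Hq.
  rewrite (Csum_ext d _ (fun j => Cmul (mid p j) (f j q))).
  - apply (Csum_mid_l d p (fun j => f j q) Hp).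
  - intros j _.
    rewrite <- (Csum_mid_l d q (f j) Hq), <- Csum_mul_l.
    apply Csum_ext; intros; ring.
Qed.

Lemma Csum2_prod m n f g :
  Csum m (fun j => Csum n (fun k => Cmul (f j) (g k))) =
  Cmul (Csum m f) (Csum n g).
Proof.
  rewrite <- Csum_mul_r; apply Csum_ext; intros; apply Csum_mul_l.
Qed.

(** Scalar counterpart of the [fold_right] that combines Kraus operators, so that sums over a Kraus
    list can be treated entry by entry. *)
Definition Lsum {A : Type} (l : list A) (f : A -> C) : C :=
  fold_right (fun x acc => Cadd (f x) acc) C0 l.

Lemma Lsum_ext {A : Type} (l : list A) (f g : A -> C) :
  (forall x, f x = g x) -> Lsum l f = Lsum l g.
Proof.
  intros H; induction l as [|x l IH]; simpl; [reflexivity|].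
  rewrite H, IH; reflexivity.
Qed.

Lemma Lsum_app {A : Type} (l1 l2 : list A) (f : A -> C) :
  Lsum (l1 ++ l2) f = Cadd (Lsum l1 f) (Lsum l2 f).
Proof. induction l1 as [|x l IH]; simpl; [|rewrite IH]; ring. Qed.

Lemma Lsum_flat_map {A B : Type} (h : A -> list B) (l : list A) (f : B -> C) :
  Lsum (flat_map h l) f = Lsum l (fun x => Lsum (h x) f).
Proof.
  induction l as [|x l IH]; simpl; [reflexivity|].
  rewrite Lsum_app, IH; reflexivity.
Qed.

Lemma Lsum_map {A B : Type} (h : A -> B) (l : list A) (f : B -> C) :
  Lsum (map h l) f = Lsum l (fun x => f (h x)).
Proof. induction l as [|x l IH]; simpl; [|rewrite IH]; reflexivity. Qed.

Lemma Lsum_seq d f : Lsum (seq 0 d) f = Csum d f.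
Proof.
  induction d as [|d IH]; [reflexivity|].
  rewrite seq_S, Lsum_app, IH; simpl; ring.
Qed.

Lemma Lsum_mul_l {A : Type} (l : list A) c (f : A -> C) :
  Lsum l (fun x => Cmul c (f x)) = Cmul c (Lsum l f).
Proof. induction l as [|x l IH]; simpl; [|rewrite IH]; ring. Qed.

(** * Kraus maps on pure states *)

Definition mapp (n : nat) (M : Mat) (v : Vec) : Vec :=
  fun i => Csum n (fun l => Cmul (M i l) (v l)).

(** [M |v><v| M^†] is the projector on [M v]: since the protocol starts from a pure state, its
    output is a sum of unnormalised pure states. *)
Lemma kraus_apply_proj n Ks v i j :
  kraus_apply n Ks (proj v) i j = Lsum Ks (fun M => proj (mapp n M v) i j).
Proof.
  induction Ks as [|M Ks IH]; [reflexivity|].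
  simpl. unfold madd at 1. fold (kraus_apply n Ks (proj v)). rewrite IH. f_equal.
  unfold mmul, proj, adj, mapp. rewrite Csum_conj, <- Csum_mul_l.
  apply Csum_ext; intros l _.
  rewrite Cconj_mul, <- Csum_mul_r.
  rewrite <- Csum_mul_r. apply Csum_ext; intros m _. ring.
Qed.

Lemma kraus_TP_Lsum n m Ks :
  kraus_TP n m Ks <->
  forall i j, (i < n)%nat -> (j < n)%nat ->
    Lsum Ks (fun M => Csum m (fun o => Cmul (Cconj (M o i)) (M o j))) = mid i j.
Proof.
  unfold kraus_TP, meq.
  assert (E : forall i j,
    fold_right (fun K acc => madd (mmul m (adj K) K) acc) mzero Ks i j =
    Lsum Ks (fun M => Csum m (fun o => Cmul (Cconj (M o i)) (M o j)))).
  { intros i j. induction Ks as [|M Ks IH]; [reflexivity|].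
    simpl. unfold madd at 1. rewrite IH. reflexivity. }
  split; intros H i j Hi Hj; specialize (H i j Hi Hj); rewrite E in *; exact H.
Qed.

(** * Splitting off one copy of each state *)

(* An index of (C^d ⊗ C^A) ⊗ (C^d ⊗ C^B) consists of the two d-valued digits
   [digit1], [digit2] and an index [rest] of C^A ⊗ C^B. *)
Definition digit1 (d A B i : nat) : nat := (i / (d * B) / A)%nat.
Definition digit2 (d B i : nat) : nat := ((i mod (d * B)) / B)%nat.
Definition rest (d A B i : nat) : nat :=
  (((i / (d * B)) mod A) * B + (i mod (d * B)) mod B)%nat.

Lemma divmod_pair n a b : (b < n)%nat ->
  ((a * n + b) / n = a)%nat /\ ((a * n + b) mod n = b)%nat.
Proof.
  intros H. split.
  - rewrite Nat.div_add_l by lia. rewrite Nat.div_small by lia. lia.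
  - rewrite Nat.add_comm, Nat.Div0.mod_add. apply Nat.mod_small; lia.
Qed.

Lemma Csum_digits d A B (h : nat -> nat -> nat -> C) :
  Csum ((d * A) * (d * B))
    (fun i => h (digit1 d A B i) (digit2 d B i) (rest d A B i)) =
  Csum d (fun p => Csum d (fun q => Csum (A * B) (fun i => h p q i))).
Proof.
  rewrite Csum_divmod, Csum_divmod. apply Csum_ext; intros p Hp.
  rewrite (Csum_ext A _ (fun p' => Csum d (fun q => Csum B (fun q' => h p q (p' * B + q')%nat)))).
  (* The second digit [q] sits between the two halves [p'] and [q'] of [rest]. *)
  - rewrite Csum_swap. apply Csum_ext; intros q Hq. rewrite Csum_divmod. reflexivity.
  - intros p' Hp'. rewrite Csum_divmod.
    apply Csum_ext; intros q Hq. apply Csum_ext; intros q' Hq'.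
    unfold digit1, digit2, rest.
    assert (Hlt : (q * B + q' < d * B)%nat) by nia.
    destruct (divmod_pair (d * B) (p * A + p') (q * B + q') Hlt) as [-> ->].
    destruct (divmod_pair A p p' Hp') as [-> ->].
    destruct (divmod_pair B q q' Hq') as [-> ->]. reflexivity.
Qed.

Lemma digits_lt d A B i : (i < (d * A) * (d * B))%nat ->
  (digit1 d A B i < d)%nat /\ (digit2 d B i < d)%nat /\ (rest d A B i < A * B)%nat.
Proof.
  intros Hi. unfold digit1, digit2, rest.
  assert (A <> 0 /\ B <> 0 /\ d <> 0)%nat as (HA & HB & Hd) by (repeat split; intros ->; lia).
  assert (HdB : (d * B <> 0)%nat) by nia.
  repeat split.
  - apply Nat.Div0.div_lt_upper_bound. apply Nat.Div0.div_lt_upper_bound. lia.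
  - apply Nat.Div0.div_lt_upper_bound. rewrite (Nat.mul_comm B d).
    apply Nat.mod_upper_bound; lia.
  - pose proof (Nat.mod_upper_bound (i / (d * B)) A HA).
    pose proof (Nat.mod_upper_bound (i mod (d * B)) B HB). nia.
Qed.

(** The digits determine the index, so the identity is a tensor product of three identities; this
    splits the trace condition of a step into that of the earlier steps and two deltas. *)
Lemma mid_digits d A B i j :
  (i < (d * A) * (d * B))%nat -> (j < (d * A) * (d * B))%nat ->
  mid i j = Cmul (Cmul (mid (digit1 d A B i) (digit1 d A B j))
                       (mid (digit2 d B i) (digit2 d B j)))
                 (mid (rest d A B i) (rest d A B j)).
Proof.
  intros Hi Hj.
  destruct (Nat.eq_dec i j) as [->|Hne]; [rewrite !mid_refl; ring|].
  rewrite (mid_neq i j Hne).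
  destruct (Nat.eq_dec (digit1 d A B i) (digit1 d A B j)) as [E1|E1];
    [|rewrite (mid_neq _ _ E1); ring].
  destruct (Nat.eq_dec (digit2 d B i) (digit2 d B j)) as [E2|E2];
    [|rewrite (mid_neq _ _ E2); ring].
  destruct (Nat.eq_dec (rest d A B i) (rest d A B j)) as [E3|E3];
    [|rewrite (mid_neq _ _ E3); ring].
  exfalso; apply Hne.
  assert (A <> 0 /\ B <> 0 /\ d <> 0)%nat as (HA & HB & Hd) by (repeat split; intros ->; lia).
  unfold digit1, digit2, rest in *.
  (* [rest] is itself a two-digit number with last digit below [B], so equal values have equal
     halves. *)
  pose proof (Nat.mod_upper_bound (i mod (d * B)) B HB) as Mi.
  pose proof (Nat.mod_upper_bound (j mod (d * B)) B HB) as Mj.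
  destruct (divmod_pair B ((i / (d * B)) mod A) _ Mi) as [F1 F2].
  destruct (divmod_pair B ((j / (d * B)) mod A) _ Mj) as [G1 G2].
  rewrite E3 in F1, F2.
  rewrite (Nat.div_mod_eq i (d * B)), (Nat.div_mod_eq j (d * B)).
  rewrite (Nat.div_mod_eq (i / (d * B)) A), (Nat.div_mod_eq (j / (d * B)) A).
  rewrite (Nat.div_mod_eq (i mod (d * B)) B), (Nat.div_mod_eq (j mod (d * B)) B).
  rewrite E1, E2, <- F1, <- F2, G1, G2. reflexivity.
Qed.

(** [vpow] peels copies off at the front, so a fresh copy of each state is the leading digit of its
    half of the index. *)
Lemma copies_digits d n psi1 psi2 i : (i < d ^ S (S n) * d ^ S n)%nat ->
  copies d (S (S n)) (S n) psi1 psi2 i =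
  Cmul (Cmul (psi1 (digit1 d (d ^ S n) (d ^ n) i)) (psi2 (digit2 d (d ^ n) i)))
       (copies d (S n) n psi1 psi2 (rest d (d ^ S n) (d ^ n) i)).
Proof.
  intros Hi.
  assert (HB : (d ^ n <> 0)%nat).
  { intros E. cbn [Nat.pow] in Hi. rewrite E in Hi. lia. }
  unfold copies.
  change (vpow d (S (S n)) psi1) with (vtens (d ^ S n) psi1 (vpow d (S n) psi1)).
  change (vpow d (S n) psi2) with (vtens (d ^ n) psi2 (vpow d n psi2)).
  unfold vtens.
  change (d ^ S n)%nat with (d * d ^ n)%nat.
  set (B := (d ^ n)%nat) in *. unfold digit1, digit2, rest.
  pose proof (Nat.mod_upper_bound (i mod (d * B)) B HB) as Mi.
  destruct (divmod_pair B ((i / (d * B)) mod (d * B)) _ Mi) as [-> ->].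
  ring.
Qed.

(** * One step of the protocol *)

(* Entry of [(1 ⊗ <j| ⊗ <k|) (a + b c + g c^2) (M ⊗ 1 ⊗ 1)], where the 3-cycle [c]
   maps [x ⊗ psi1 ⊗ psi2] to [psi1 ⊗ psi2 ⊗ x]. *)
Definition step_op (d A B : nat) (a b g : R) (M : Mat) (j k : nat) : Mat :=
  fun o i =>
    let p := digit1 d A B i in let q := digit2 d B i in let i' := rest d A B i in
    Cadd (Cadd
      (Cmul (RtoC a) (Cmul (Cmul (mid j p) (mid k q)) (M o i')))
      (Cmul (RtoC b) (Cmul (Cmul (mid o p) (mid j q)) (M k i'))))
      (Cmul (RtoC g) (Cmul (Cmul (mid k p) (mid o q)) (M j i'))).

(** Discarding two factors has the Kraus operators [1 ⊗ <j| ⊗ <k|]. Each [M] first turns the older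
    copies into the current state; the cycle then acts with one fresh copy of either state. *)
Definition step_kraus (d A B : nat) (a b g : R) (Ks : list Mat) : list Mat :=
  flat_map (fun M => flat_map (fun j =>
    map (fun k => step_op d A B a b g M j k) (seq 0 d)) (seq 0 d)) Ks.

Lemma Lsum_step_kraus d A B a b g Ks f :
  Lsum (step_kraus d A B a b g Ks) f =
  Lsum Ks (fun M => Csum d (fun j => Csum d (fun k => f (step_op d A B a b g M j k)))).
Proof.
  unfold step_kraus. rewrite Lsum_flat_map. apply Lsum_ext; intros M.
  rewrite Lsum_flat_map, Lsum_seq. apply Csum_ext; intros j _.
  rewrite Lsum_map, Lsum_seq. reflexivity.
Qed.

Lemma Csum3_rotate l m n (f : nat -> nat -> nat -> C) :
  Csum l (fun i => Csum m (fun j => Csum n (fun k => f i j k))) =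
  Csum n (fun k => Csum l (fun i => Csum m (fun j => f i j k))).
Proof.
  rewrite (Csum_swap n l). apply Csum_ext; intros i _. apply Csum_swap.
Qed.

Lemma Csum2_linear3 d x y z (f g h : nat -> nat -> C) :
  Csum d (fun j => Csum d (fun k =>
    Cadd (Cadd (Cmul x (f j k)) (Cmul y (g j k))) (Cmul z (h j k)))) =
  Cadd (Cadd (Cmul x (Csum d (fun j => Csum d (f j))))
             (Cmul y (Csum d (fun j => Csum d (g j)))))
       (Cmul z (Csum d (fun j => Csum d (h j)))).
Proof.
  rewrite <- !Csum_mul_l, <- !Csum_add. apply Csum_ext; intros j _.
  rewrite <- !Csum_mul_l, <- !Csum_add. reflexivity.
Qed.

(* The conditions say exactly that [a + b c + g c^2] is unitary. *)
Lemma step_kraus_TP d A B a b g Ks :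
  a * a + b * b + g * g = 1 -> a * b + b * g + g * a = 0 ->
  kraus_TP (A * B) d Ks ->
  kraus_TP ((d * A) * (d * B)) d (step_kraus d A B a b g Ks).
Proof.
  intros H1 H2. rewrite !kraus_TP_Lsum. intros IH i l Hi Hl.
  rewrite Lsum_step_kraus.
  rewrite (mid_digits d A B i l Hi Hl).
  destruct (digits_lt d A B i Hi) as (Hp & Hq & Hi').
  destruct (digits_lt d A B l Hl) as (Hr & Hs & Hl').
  rewrite <- (IH _ _ Hi' Hl'), <- Lsum_mul_l.
  apply Lsum_ext; intros M. unfold step_op; cbv zeta.
  set (p := digit1 d A B i) in *. set (q := digit2 d B i) in *.
  set (r := digit1 d A B l) in *. set (s := digit2 d B l) in *.
  set (i' := rest d A B i) in *. set (l' := rest d A B l) in *.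
  set (G := fun o j k =>
    Cadd (Cadd
      (Cmul (RtoC a) (Cmul (Cmul (mid j r) (mid k s)) (M o l')))
      (Cmul (RtoC b) (Cmul (Cmul (mid o r) (mid j s)) (M k l'))))
      (Cmul (RtoC g) (Cmul (Cmul (mid k r) (mid o s)) (M j l')))).
  (* Only the conjugated operator is expanded: in each of its three terms two deltas fix two of [j],
     [k], [o], and the third is summed last. *)
  transitivity (Csum d (fun j => Csum d (fun k =>
    Cadd (Cadd
      (Cmul (RtoC a) (Csum d (fun o =>
        Cmul (Cmul (mid p j) (mid q k)) (Cmul (Cconj (M o i')) (G o j k)))))
      (Cmul (RtoC b) (Csum d (fun o =>
        Cmul (Cmul (mid p o) (mid q j)) (Cmul (Cconj (M k i')) (G o j k))))))
      (Cmul (RtoC g) (Csum d (fun o =>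
        Cmul (Cmul (mid p k) (mid q o)) (Cmul (Cconj (M j i')) (G o j k)))))))).
  { apply Csum_ext; intros j _; apply Csum_ext; intros k _.
    rewrite <- !Csum_mul_l, <- !Csum_add. apply Csum_ext; intros o _.
    fold (G o j k).
    rewrite !Cconj_add, !Cconj_mul, !Cconj_RtoC, !Cconj_mid.
    rewrite (mid_sym j p), (mid_sym k q), (mid_sym o p), (mid_sym j q),
      (mid_sym k p), (mid_sym o q). ring. }
  rewrite (Csum2_linear3 d).
  rewrite (Csum3_rotate d d d (fun j k o =>
    Cmul (Cmul (mid p j) (mid q k)) (Cmul (Cconj (M o i')) (G o j k)))).
  rewrite <- (Csum3_rotate d d d (fun k o j =>
    Cmul (Cmul (mid p o) (mid q j)) (Cmul (Cconj (M k i')) (G o j k)))).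
  rewrite (Csum_ext d _ (fun o => Cmul (Cconj (M o i')) (G o p q)))
    by (intros x _; apply (Csum2_mid d p q
          (fun j k => Cmul (Cconj (M x i')) (G x j k)) Hp Hq)).
  rewrite (Csum_ext d (fun k => Csum d (fun o => Csum d (fun j => _)))
            (fun k => Cmul (Cconj (M k i')) (G p q k)))
    by (intros x _; apply (Csum2_mid d p q
          (fun o j => Cmul (Cconj (M x i')) (G o j x)) Hp Hq)).
  rewrite (Csum_ext d (fun j => Csum d (fun k => Csum d (fun o => _)))
            (fun j => Cmul (Cconj (M j i')) (G q j p)))
    by (intros x _; apply (Csum2_mid d p q
          (fun k o => Cmul (Cconj (M x i')) (G o x k)) Hp Hq)).
  set (T := Csum d (fun o => Cmul (Cconj (M o i')) (M o l'))).
  (* In the remaining sum, one term of [G] reproduces [T], while the other two carry a delta in the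
     summation index. *)
  assert (E : forall x y z u w c1 c2 c3, (u < d)%nat -> (w < d)%nat ->
    Csum d (fun o => Cmul (Cconj (M o i'))
      (Cadd (Cadd (Cmul x (Cmul c1 (M o l'))) (Cmul y (Cmul (mid o u) c2)))
            (Cmul z (Cmul (mid o w) c3)))) =
    Cadd (Cadd (Cmul x (Cmul c1 T)) (Cmul y (Cmul (Cconj (M u i')) c2)))
         (Cmul z (Cmul (Cconj (M w i')) c3))).
  { intros x y z u w c1 c2 c3 Hu Hw. unfold T.
    rewrite <- (Csum_mid_r d u (fun o => Cmul (Cconj (M o i')) c2) Hu).
    rewrite <- (Csum_mid_r d w (fun o => Cmul (Cconj (M o i')) c3) Hw).
    rewrite <- !Csum_mul_l, <- !Csum_add. apply Csum_ext; intros; ring. }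
  rewrite (Csum_ext d (fun o => Cmul (Cconj (M o i')) (G o p q)) (fun o =>
    Cmul (Cconj (M o i'))
      (Cadd (Cadd (Cmul (RtoC a) (Cmul (Cmul (mid p r) (mid q s)) (M o l')))
                  (Cmul (RtoC b) (Cmul (mid o r) (Cmul (mid p s) (M q l')))))
            (Cmul (RtoC g) (Cmul (mid o s) (Cmul (mid q r) (M p l')))))))
    by (intros; unfold G; ring).
  rewrite (Csum_ext d (fun o => Cmul (Cconj (M o i')) (G p q o)) (fun o =>
    Cmul (Cconj (M o i'))
      (Cadd (Cadd (Cmul (RtoC b) (Cmul (Cmul (mid p r) (mid q s)) (M o l')))
                  (Cmul (RtoC a) (Cmul (mid o s) (Cmul (mid q r) (M p l')))))
            (Cmul (RtoC g) (Cmul (mid o r) (Cmul (mid p s) (M q l')))))))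
    by (intros; unfold G; ring).
  rewrite (Csum_ext d (fun o => Cmul (Cconj (M o i')) (G q o p)) (fun o =>
    Cmul (Cconj (M o i'))
      (Cadd (Cadd (Cmul (RtoC g) (Cmul (Cmul (mid p r) (mid q s)) (M o l')))
                  (Cmul (RtoC a) (Cmul (mid o r) (Cmul (mid p s) (M q l')))))
            (Cmul (RtoC b) (Cmul (mid o s) (Cmul (mid q r) (M p l')))))))
    by (intros; unfold G; ring).
  rewrite !E by assumption.
  assert (C1eq : Cadd (Cadd (Cmul (RtoC a) (RtoC a)) (Cmul (RtoC b) (RtoC b)))
                      (Cmul (RtoC g) (RtoC g)) = C1)
    by (rewrite <- !RtoC_mul, <- !RtoC_add, H1; reflexivity).
  assert (C0eq : Cadd (Cadd (Cmul (RtoC a) (RtoC b)) (Cmul (RtoC b) (RtoC g)))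
                      (Cmul (RtoC g) (RtoC a)) = C0)
    by (rewrite <- !RtoC_mul, <- !RtoC_add, H2; reflexivity).
  (* The nine products regroup as [U^† U = (a^2 + b^2 + g^2) + (a b + b g + g a) (c + c^2)]. *)
  transitivity (Cadd
    (Cmul (Cadd (Cadd (Cmul (RtoC a) (RtoC a)) (Cmul (RtoC b) (RtoC b)))
                (Cmul (RtoC g) (RtoC g))) (Cmul (Cmul (mid p r) (mid q s)) T))
    (Cmul (Cadd (Cadd (Cmul (RtoC a) (RtoC b)) (Cmul (RtoC b) (RtoC g)))
                (Cmul (RtoC g) (RtoC a)))
      (Cadd (Cmul (Cconj (M r i')) (Cmul (mid p s) (M q l')))
            (Cmul (Cconj (M s i')) (Cmul (mid q r) (M p l')))))); [ring|].
  rewrite C1eq, C0eq; ring.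
Qed.

(** On a product input the deltas collapse, and the three powers of [c] place [y], [psi1] and [psi2]
    in turn in the output factor. *)
Lemma step_op_copies d n a b g M j k psi1 psi2 o :
  (j < d)%nat -> (k < d)%nat -> (o < d)%nat ->
  let y := mapp (d ^ S n * d ^ n) M (copies d (S n) n psi1 psi2) in
  mapp (d ^ S (S n) * d ^ S n) (step_op d (d ^ S n) (d ^ n) a b g M j k)
    (copies d (S (S n)) (S n) psi1 psi2) o =
  Cadd (Cadd
    (Cmul (RtoC a) (Cmul (y o) (Cmul (psi1 j) (psi2 k))))
    (Cmul (RtoC b) (Cmul (psi1 o) (Cmul (psi2 j) (y k)))))
    (Cmul (RtoC g) (Cmul (psi2 o) (Cmul (y j) (psi1 k)))).
Proof.
  intros Hj Hk Ho y. unfold mapp at 1.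
  set (v := copies d (S n) n psi1 psi2) in *.
  set (A := (d ^ S n)%nat) in *. set (B := (d ^ n)%nat) in *.
  set (h := fun p q i => Cmul (Cadd (Cadd
      (Cmul (RtoC a) (Cmul (Cmul (mid j p) (mid k q)) (M o i)))
      (Cmul (RtoC b) (Cmul (Cmul (mid o p) (mid j q)) (M k i))))
      (Cmul (RtoC g) (Cmul (Cmul (mid k p) (mid o q)) (M j i))))
      (Cmul (Cmul (psi1 p) (psi2 q)) (v i))).
  rewrite (Csum_ext _ _ (fun i => h (digit1 d A B i) (digit2 d B i) (rest d A B i)))
    by (intros i Hi; rewrite copies_digits by exact Hi; reflexivity).
  change (d ^ S (S n) * A)%nat with ((d * A) * (d * B))%nat.
  rewrite Csum_digits.
  rewrite (Csum_ext d _ (fun p => Csum d (fun q => Cadd (Cadd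
    (Cmul (RtoC a) (Cmul (Cmul (mid j p) (mid k q)) (Cmul (Cmul (psi1 p) (psi2 q)) (y o))))
    (Cmul (RtoC b) (Cmul (Cmul (mid o p) (mid j q)) (Cmul (Cmul (psi1 p) (psi2 q)) (y k)))))
    (Cmul (RtoC g) (Cmul (Cmul (mid k p) (mid o q)) (Cmul (Cmul (psi1 p) (psi2 q)) (y j))))))).
  - rewrite Csum2_linear3.
    rewrite (Csum2_mid d j k (fun p q => Cmul (Cmul (psi1 p) (psi2 q)) (y o))) by assumption.
    rewrite (Csum2_mid d o j (fun p q => Cmul (Cmul (psi1 p) (psi2 q)) (y k))) by assumption.
    rewrite (Csum2_mid d k o (fun p q => Cmul (Cmul (psi1 p) (psi2 q)) (y j))) by assumption.
    ring.
  - intros p _. apply Csum_ext; intros q _. unfold y, mapp.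
    rewrite <- !Csum_mul_l, <- !Csum_add. apply Csum_ext; intros i _. unfold h. ring.
Qed.

(* [a^2 σ + (b^2 ρ1 + g^2 ρ2) tr σ + ab (σ ρ2 ρ1 + ρ1 ρ2 σ) + ag (σ ρ1 ρ2 + ρ2 ρ1 σ)
   + bg (ρ1 σ ρ2 + ρ2 σ ρ1)], with [ρ1], [ρ2] the projectors on [u], [w]. *)
Definition step_map (d : nat) (a b g : R) (u w : Vec) (s : Mat) : Mat :=
  fun i j =>
  let right v := Csum d (fun l => Cmul (s i l) (v l)) in
  let left v := Csum d (fun l => Cmul (Cconj (v l)) (s l j)) in
  let form v v' := Csum d (fun l => Cmul (Cconj (v l)) (Csum d (fun m => Cmul (s l m) (v' m)))) in
  Cadd (Cadd (Cadd (Cadd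
    (Cmul (RtoC (a * a)) (s i j))
    (Cmul (Cadd (Cmul (RtoC (b * b)) (proj u i j)) (Cmul (RtoC (g * g)) (proj w i j)))
          (trace d s)))
    (Cmul (RtoC (a * b))
       (Cadd (Cmul (right w) (Cmul (inner d w u) (Cconj (u j))))
             (Cmul (left w) (Cmul (inner d u w) (u i))))))
    (Cmul (RtoC (a * g))
       (Cadd (Cmul (right u) (Cmul (inner d u w) (Cconj (w j))))
             (Cmul (left u) (Cmul (inner d w u) (w i))))))
    (Cmul (RtoC (b * g))
       (Cadd (Cmul (form u w) (Cmul (u i) (Cconj (w j))))
             (Cmul (form w u) (Cmul (w i) (Cconj (u j)))))).

(** Linearity carries the formula for a step from a pure state [y], where it is computed, to the
    mixture left by the earlier steps. *)
Lemma step_map_add d a b g u w s1 s2 i j :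
  step_map d a b g u w (madd s1 s2) i j =
  Cadd (step_map d a b g u w s1 i j) (step_map d a b g u w s2 i j).
Proof.
  unfold step_map, trace, madd; cbv zeta.
  assert (Z1 : forall i (v : Vec),
    Csum d (fun l => Cmul (Cadd (s1 i l) (s2 i l)) (v l)) =
    Cadd (Csum d (fun l => Cmul (s1 i l) (v l))) (Csum d (fun l => Cmul (s2 i l) (v l))))
    by (intros; rewrite <- Csum_add; apply Csum_ext; intros; ring).
  assert (Z2 : forall (v f f' : Vec),
    Csum d (fun l => Cmul (Cconj (v l)) (Cadd (f l) (f' l))) =
    Cadd (Csum d (fun l => Cmul (Cconj (v l)) (f l)))
         (Csum d (fun l => Cmul (Cconj (v l)) (f' l))))
    by (intros; rewrite <- Csum_add; apply Csum_ext; intros; ring).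
  assert (Z3 : forall (v v' : Vec),
    Csum d (fun l => Cmul (Cconj (v l))
      (Csum d (fun m => Cmul (Cadd (s1 l m) (s2 l m)) (v' m)))) =
    Cadd (Csum d (fun l => Cmul (Cconj (v l)) (Csum d (fun m => Cmul (s1 l m) (v' m)))))
         (Csum d (fun l => Cmul (Cconj (v l)) (Csum d (fun m => Cmul (s2 l m) (v' m)))))).
  { intros v v'. rewrite <- Z2. apply Csum_ext; intros; rewrite Z1; reflexivity. }
  rewrite (Z2 u (fun l => s1 l j) (fun l => s2 l j)).
  rewrite (Z2 w (fun l => s1 l j) (fun l => s2 l j)).
  rewrite !(Z3 u w), !(Z3 w u), !(Z1 i w), !(Z1 i u).
  rewrite (Csum_add d (fun i => s1 i i) (fun i => s2 i i)). ring.
Qed.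

Lemma step_map_zero d a b g u w i j : step_map d a b g u w mzero i j = C0.
Proof.
  unfold step_map, trace, mzero; cbv zeta.
  assert (Z1 : forall v : Vec, Csum d (fun l => Cmul C0 (v l)) = C0)
    by (intros; rewrite Csum_mul_l; ring).
  assert (Z2 : forall v : Vec, Csum d (fun l => Cmul (Cconj (v l)) C0) = C0)
    by (intros; rewrite Csum_mul_r; ring).
  rewrite !Z1, !Z2, Csum_zero. ring.
Qed.

Lemma step_map_Lsum {T : Type} d a b g u w (l : list T) (S : T -> Mat) i j :
  step_map d a b g u w (fun i j => Lsum l (fun x => S x i j)) i j =
  Lsum l (fun x => step_map d a b g u w (S x) i j).
Proof.
  induction l as [|x l IH]; simpl; [apply step_map_zero|].
  rewrite <- IH. apply step_map_add.
Qed.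

Lemma step_map_ext d a b g u w s s' :
  meq d d s s' -> meq d d (step_map d a b g u w s) (step_map d a b g u w s').
Proof.
  intros H i j Hi Hj. unfold step_map, trace; cbv zeta.
  assert (Z1 : forall i (v : Vec), (i < d)%nat ->
    Csum d (fun l => Cmul (s i l) (v l)) = Csum d (fun l => Cmul (s' i l) (v l)))
    by (intros; apply Csum_ext; intros; rewrite H by assumption; reflexivity).
  assert (Z2 : forall (v : Vec),
    Csum d (fun l => Cmul (Cconj (v l)) (s l j)) = Csum d (fun l => Cmul (Cconj (v l)) (s' l j)))
    by (intros; apply Csum_ext; intros; rewrite H by assumption; reflexivity).
  assert (Z3 : forall (v v' : Vec),
    Csum d (fun l => Cmul (Cconj (v l)) (Csum d (fun m => Cmul (s l m) (v' m)))) =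
    Csum d (fun l => Cmul (Cconj (v l)) (Csum d (fun m => Cmul (s' l m) (v' m)))))
    by (intros; apply Csum_ext; intros; rewrite Z1 by assumption; reflexivity).
  rewrite !Z1, !Z2, !Z3, (H i j Hi Hj) by assumption.
  rewrite (Csum_ext d (fun i => s i i) (fun i => s' i i)) by (intros; apply H; assumption).
  reflexivity.
Qed.

(** The sum over [j'] and [k] is the partial trace: each of the nine products of terms becomes an
    outer product times two overlaps, with [<u|u>] and [<w|w>] equal to 1. *)
Lemma step_map_proj d a b g u w y i j :
  unit_vec d u -> unit_vec d w ->
  Csum d (fun j' => Csum d (fun k =>
    let z o := Cadd (Cadd
      (Cmul (RtoC a) (Cmul (y o) (Cmul (u j') (w k))))
      (Cmul (RtoC b) (Cmul (u o) (Cmul (w j') (y k)))))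
      (Cmul (RtoC g) (Cmul (w o) (Cmul (y j') (u k)))) in
    Cmul (z i) (Cconj (z j)))) =
  step_map d a b g u w (proj y) i j.
Proof.
  intros Hu Hw.
  (* [x], [v], [t] are the three factors of the ket, [x'], [v'], [t'] those of the bra. *)
  set (T := fun (x v t x' v' t' : Vec) (j' k : nat) =>
    Cmul (Cmul (x i) (Cmul (v j') (t k))) (Cconj (Cmul (x' j) (Cmul (v' j') (t' k))))).
  assert (ET : forall x v t x' v' t',
    Csum d (fun j' => Csum d (T x v t x' v' t' j')) =
    Cmul (Cmul (x i) (Cconj (x' j))) (Cmul (inner d v' v) (inner d t' t))).
  { intros. unfold inner. rewrite <- Csum2_prod, <- Csum_mul_l.
    apply Csum_ext; intros j' _. rewrite <- Csum_mul_l. apply Csum_ext; intros k _.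
    unfold T. rewrite !Cconj_mul. ring. }
  transitivity (Cadd (Cadd
    (Cmul (RtoC a) (Cadd (Cadd
      (Cmul (RtoC a) (Csum d (fun j' => Csum d (T y u w y u w j'))))
      (Cmul (RtoC b) (Csum d (fun j' => Csum d (T y u w u w y j')))))
      (Cmul (RtoC g) (Csum d (fun j' => Csum d (T y u w w y u j'))))))
    (Cmul (RtoC b) (Cadd (Cadd
      (Cmul (RtoC a) (Csum d (fun j' => Csum d (T u w y y u w j'))))
      (Cmul (RtoC b) (Csum d (fun j' => Csum d (T u w y u w y j')))))
      (Cmul (RtoC g) (Csum d (fun j' => Csum d (T u w y w y u j')))))))
    (Cmul (RtoC g) (Cadd (Cadd
      (Cmul (RtoC a) (Csum d (fun j' => Csum d (T w y u y u w j'))))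
      (Cmul (RtoC b) (Csum d (fun j' => Csum d (T w y u u w y j')))))
      (Cmul (RtoC g) (Csum d (fun j' => Csum d (T w y u w y u j'))))))).
  - rewrite <- !Csum2_linear3. apply Csum_ext; intros j' _. apply Csum_ext; intros k _.
    cbv zeta. unfold T. rewrite !Cconj_add, !Cconj_mul, !Cconj_RtoC. ring.
  - rewrite !ET. unfold unit_vec in Hu, Hw. rewrite Hu, Hw.
    unfold step_map; cbv zeta.
    assert (R1 : forall i (v : Vec), Csum d (fun l => Cmul (proj y i l) (v l)) =
                  Cmul (y i) (inner d y v))
      by (intros; unfold inner, proj; rewrite <- Csum_mul_l; apply Csum_ext; intros; ring).
    assert (R2 : forall (v : Vec), Csum d (fun l => Cmul (Cconj (v l)) (proj y l j)) =
                  Cmul (inner d v y) (Cconj (y j)))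
      by (intros; unfold inner, proj; rewrite <- Csum_mul_r; apply Csum_ext; intros; ring).
    assert (R3 : forall (v v' : Vec), Csum d (fun l => Cmul (Cconj (v l))
       (Csum d (fun m => Cmul (proj y l m) (v' m)))) = Cmul (inner d v y) (inner d y v')).
    { intros v v'. unfold inner at 1. rewrite <- Csum_mul_r.
      apply Csum_ext; intros; rewrite R1; ring. }
    assert (R4 : trace d (proj y) = inner d y y)
      by (unfold trace, inner, proj; apply Csum_ext; intros; ring).
    rewrite !R1, !R2, !R3, R4, !RtoC_mul. unfold proj. ring.
Qed.

Lemma step_kraus_apply d n a b g Ks psi1 psi2 :
  unit_vec d psi1 -> unit_vec d psi2 ->
  meq d d
    (kraus_apply (d ^ S (S n) * d ^ S n) (step_kraus d (d ^ S n) (d ^ n) a b g Ks)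
       (proj (copies d (S (S n)) (S n) psi1 psi2)))
    (step_map d a b g psi1 psi2
       (kraus_apply (d ^ S n * d ^ n) Ks (proj (copies d (S n) n psi1 psi2)))).
Proof.
  intros H1 H2 i j Hi Hj.
  rewrite kraus_apply_proj, Lsum_step_kraus.
  rewrite (step_map_ext d a b g psi1 psi2 _ (fun i j => Lsum Ks (fun M =>
    proj (mapp (d ^ S n * d ^ n) M (copies d (S n) n psi1 psi2)) i j)))
    by first [assumption | intros x y _ _; apply kraus_apply_proj].
  rewrite step_map_Lsum. apply Lsum_ext; intros M.
  rewrite <- step_map_proj by assumption.
  apply Csum_ext; intros j' Hj'. apply Csum_ext; intros k Hk.
  unfold proj. cbv zeta. rewrite !step_op_copies by assumption. reflexivity.
Qed.

(** * Operators on the plane spanned by the two states *)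

(** The real symmetric matrix with rows [(p, q)] and [(q, r)] in the basis [e1], [e2], extended by
    zero. *)
Definition plane_op (e1 e2 : Vec) (p q r : R) : Mat := fun i j =>
  Cadd (Cadd (Cmul (RtoC p) (proj e1 i j))
    (Cmul (RtoC q) (Cadd (Cmul (e1 i) (Cconj (e2 j))) (Cmul (e2 i) (Cconj (e1 j))))))
    (Cmul (RtoC r) (proj e2 i j)).

Definition orthonormal2 (d : nat) (e1 e2 : Vec) : Prop :=
  unit_vec d e1 /\ unit_vec d e2 /\ inner d e1 e2 = C0.

Lemma inner_conj d u v : Cconj (inner d u v) = inner d v u.
Proof.
  unfold inner; rewrite Csum_conj; apply Csum_ext; intros.
  rewrite Cconj_mul, Cconj_conj; ring.
Qed.

Lemma plane_op_right d e1 e2 p q r v i :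
  Csum d (fun l => Cmul (plane_op e1 e2 p q r i l) (v l)) =
  Cadd (Cmul (Cadd (Cmul (RtoC p) (e1 i)) (Cmul (RtoC q) (e2 i))) (inner d e1 v))
       (Cmul (Cadd (Cmul (RtoC q) (e1 i)) (Cmul (RtoC r) (e2 i))) (inner d e2 v)).
Proof.
  unfold inner. rewrite <- !Csum_mul_l, <- Csum_add.
  apply Csum_ext; intros. unfold plane_op, proj. ring.
Qed.

Lemma plane_op_left d e1 e2 p q r v j :
  Csum d (fun l => Cmul (Cconj (v l)) (plane_op e1 e2 p q r l j)) =
  Cadd (Cmul (inner d v e1) (Cadd (Cmul (RtoC p) (Cconj (e1 j))) (Cmul (RtoC q) (Cconj (e2 j)))))
       (Cmul (inner d v e2) (Cadd (Cmul (RtoC q) (Cconj (e1 j))) (Cmul (RtoC r) (Cconj (e2 j))))).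
Proof.
  unfold inner. rewrite <- !Csum_mul_r, <- Csum_add.
  apply Csum_ext; intros. unfold plane_op, proj. ring.
Qed.

Lemma plane_op_form d e1 e2 p q r v v' :
  Csum d (fun l => Cmul (Cconj (v l))
    (Csum d (fun m => Cmul (plane_op e1 e2 p q r l m) (v' m)))) =
  Cadd (Cmul (Cadd (Cmul (RtoC p) (inner d v e1)) (Cmul (RtoC q) (inner d v e2))) (inner d e1 v'))
       (Cmul (Cadd (Cmul (RtoC q) (inner d v e1)) (Cmul (RtoC r) (inner d v e2))) (inner d e2 v')).
Proof.
  rewrite (Csum_ext d _ (fun l =>
   Cadd (Cmul (Cadd (Cmul (RtoC p) (Cmul (Cconj (v l)) (e1 l)))
                    (Cmul (RtoC q) (Cmul (Cconj (v l)) (e2 l)))) (inner d e1 v'))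
        (Cmul (Cadd (Cmul (RtoC q) (Cmul (Cconj (v l)) (e1 l)))
                    (Cmul (RtoC r) (Cmul (Cconj (v l)) (e2 l)))) (inner d e2 v')))).
  - rewrite Csum_add, !Csum_mul_r, !Csum_add, !Csum_mul_l. reflexivity.
  - intros l _. rewrite plane_op_right. ring.
Qed.

Lemma plane_op_trace d e1 e2 p q r :
  orthonormal2 d e1 e2 -> trace d (plane_op e1 e2 p q r) = RtoC (p + r).
Proof.
  intros (H1 & H2 & H3).
  assert (H4 : inner d e2 e1 = C0) by (rewrite <- inner_conj, H3; apply Cconj_0).
  transitivity (Cadd (Cadd (Cmul (RtoC p) (inner d e1 e1))
    (Cmul (RtoC q) (Cadd (inner d e2 e1) (inner d e1 e2))))
    (Cmul (RtoC r) (inner d e2 e2))).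
  - unfold inner, trace. rewrite <- Csum_add, <- !Csum_mul_l, <- !Csum_add.
    apply Csum_ext; intros. unfold plane_op, proj. ring.
  - unfold unit_vec in *. rewrite H1, H2, H3, H4, RtoC_add. ring.
Qed.

Lemma inner_linear_r d u v w x y :
  inner d u (fun i => Cadd (Cmul x (v i)) (Cmul y (w i))) =
  Cadd (Cmul x (inner d u v)) (Cmul y (inner d u w)).
Proof.
  unfold inner. rewrite <- !Csum_mul_l, <- Csum_add. apply Csum_ext; intros; ring.
Qed.

(** A step involves only [e1], [w] and the range and entries of the operator, and [w] has real
    coordinates; so both the plane and realness are preserved. *)
Lemma step_map_plane d a b g e1 e2 k s p q r :
  orthonormal2 d e1 e2 ->
  let w := fun i => Cadd (Cmul (RtoC k) (e1 i)) (Cmul (RtoC s) (e2 i)) in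
  meq d d (step_map d a b g e1 w (plane_op e1 e2 p q r))
    (plane_op e1 e2
      (a * a * p + (b * b + g * g * (k * k)) * (p + r)
       + 2 * (a * b) * (k * k * p + k * s * q) + 2 * (a * g) * (k * k * p)
       + 2 * (b * g) * (k * k * p + k * s * q))
      (a * a * q + g * g * (k * s) * (p + r)
       + a * b * (k * k * q + k * s * r) + a * g * (k * k * q + k * s * p)
       + b * g * (k * s * p + s * s * q))
      (a * a * r + g * g * (s * s) * (p + r) + 2 * (a * g) * (k * s * q))).
Proof.
  intros Ho w i j _ _. destruct Ho as (H1 & H2 & H3) eqn:E. clear E.
  assert (H4 : inner d e2 e1 = C0) by (rewrite <- inner_conj, H3; apply Cconj_0).
  unfold unit_vec in H1, H2.
  assert (I1 : inner d e1 w = RtoC k)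
    by (unfold w; rewrite inner_linear_r, H1, H3; ring).
  assert (I2 : inner d e2 w = RtoC s)
    by (unfold w; rewrite inner_linear_r, H2, H4; ring).
  assert (I3 : inner d w e1 = RtoC k) by (rewrite <- inner_conj, I1; apply Cconj_RtoC).
  assert (I4 : inner d w e2 = RtoC s) by (rewrite <- inner_conj, I2; apply Cconj_RtoC).
  unfold step_map; cbv zeta.
  rewrite !plane_op_right, !plane_op_left, !plane_op_form, plane_op_trace by assumption.
  rewrite !H1, !H3, !H4, !I1, !I2, !I3, !I4.
  unfold plane_op, proj, w.
  rewrite !Cconj_add, !Cconj_mul, !Cconj_RtoC.
  assert (T2 : RtoC 2 = Cadd C1 C1) by (apply C_eq; simpl; ring).
  repeat rewrite ?RtoC_add, ?RtoC_mul. rewrite T2. ring.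
Qed.

(* Squaring such an operator with [r = - p] gives [p^2 + q^2] times the projector on the
   plane, so its absolute value is explicit. *)
Lemma plane_trace_dist d e1 e2 rho sigma p q r p' q' r' delta :
  orthonormal2 d e1 e2 ->
  meq d d rho (plane_op e1 e2 p q r) -> meq d d sigma (plane_op e1 e2 p' q' r') ->
  p + r = p' + r' ->
  sqrt ((p - p') ^ 2 + (q - q') ^ 2) <= delta ->
  trace_dist_le d rho sigma delta.
Proof.
  intros Ho Hr Hs Ht Hd.
  destruct Ho as (H1 & H2 & H3) eqn:E. clear E.
  assert (H4 : inner d e2 e1 = C0) by (rewrite <- inner_conj, H3; apply Cconj_0).
  unfold unit_vec in H1, H2.
  set (x := p - p') in *. set (y := q - q') in *. set (L := sqrt (x ^ 2 + y ^ 2)) in *.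
  assert (LL : L * L = x ^ 2 + y ^ 2) by (apply sqrt_sqrt; nra).
  assert (L0 : 0 <= L) by apply sqrt_pos.
  (* A product of two symmetric matrices need not be symmetric, hence four entries. *)
  assert (M : forall p q r p' q' r' i j,
    Csum d (fun l => Cmul (plane_op e1 e2 p q r i l) (plane_op e1 e2 p' q' r' l j)) =
    Cadd (Cadd (Cmul (RtoC (p * p' + q * q')) (proj e1 i j))
      (Cadd (Cmul (RtoC (p * q' + q * r')) (Cmul (e1 i) (Cconj (e2 j))))
            (Cmul (RtoC (q * p' + r * q')) (Cmul (e2 i) (Cconj (e1 j))))))
      (Cmul (RtoC (q * q' + r * r')) (proj e2 i j))).
  { intros. rewrite (plane_op_right d e1 e2 _ _ _ (fun l => plane_op e1 e2 p'0 q'0 r'0 l j)).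
    unfold inner. rewrite !plane_op_left, H1, H2, H3, H4, !RtoC_add, !RtoC_mul.
    unfold proj. ring. }
  (* The traceless difference has eigenvalues [L] and [- L]. *)
  exists (2 * L). split; [|lra].
  exists (plane_op e1 e2 L 0 L). split; [|split].
  - split.
    + intros i j _ _. unfold plane_op, proj.
      rewrite !Cconj_add, !Cconj_mul, !Cconj_add, !Cconj_mul, !Cconj_RtoC, !Cconj_conj. ring.
    + intros v.
      rewrite (Csum_ext d _ (fun i => Cmul (Cconj (v i))
        (Csum d (fun m => Cmul (plane_op e1 e2 L 0 L i m) (v m)))))
        by (intros; apply Csum_mul_l).
      rewrite plane_op_form, <- (inner_conj d e1 v), <- (inner_conj d e2 v).
      simpl. nra.
  - intros i j Hi Hj. unfold mmul. rewrite M.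
    assert (E : forall i j, (i < d)%nat -> (j < d)%nat ->
       msub rho sigma i j = plane_op e1 e2 x y (- x) i j).
    { intros i' j' Hi' Hj'. unfold msub. rewrite Hr, Hs by assumption.
      assert (Er : r = r' + - x) by (unfold x; lra).
      assert (Ep : p = p' + x) by (unfold x; lra).
      assert (Eq : q = q' + y) by (unfold y; lra).
      unfold plane_op. rewrite Er, Ep, Eq, !RtoC_add. ring. }
    rewrite (Csum_ext d _ (fun l => Cmul (plane_op e1 e2 x y (- x) i l)
                                        (plane_op e1 e2 x y (- x) l j))).
    + rewrite M.
      replace (x * x + y * y) with (L * L) by (rewrite LL; ring).
      replace (y * y + - x * - x) with (L * L) by (rewrite LL; ring).
      replace (L * L + 0 * 0) with (L * L) by ring.
      replace (0 * 0 + L * L) with (L * L) by ring.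
      replace (L * 0 + 0 * L) with 0 by ring.
      replace (0 * L + L * 0) with 0 by ring.
      replace (x * y + y * - x) with 0 by ring.
      replace (y * x + - x * y) with 0 by ring. reflexivity.
    + intros l Hl. unfold adj. rewrite !E by assumption. f_equal.
      unfold plane_op, proj.
      rewrite !Cconj_add, !Cconj_mul, !Cconj_add, !Cconj_mul, !Cconj_RtoC, !Cconj_conj. ring.
  - rewrite plane_op_trace by assumption. simpl. ring.
Qed.

(** * The planar recursion *)

(* [a + b c + g c^2] is the rotation about [(1,1,1)] given by the quaternion
   [1 + t (i + j + k)], so that unitarity needs no condition on [t]. *)
Definition coefA (t : R) : R := (1 - t * t) / (1 + 3 * (t * t)).
Definition coefB (t : R) : R := (2 * (t * t) + 2 * t) / (1 + 3 * (t * t)).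
Definition coefG (t : R) : R := (2 * (t * t) - 2 * t) / (1 + 3 * (t * t)).

Lemma coef_den t : 1 + 3 * (t * t) <> 0.
Proof. nra. Qed.

Lemma coef_sqr t :
  coefA t * coefA t + coefB t * coefB t + coefG t * coefG t = 1.
Proof. unfold coefA, coefB, coefG. field. apply coef_den. Qed.

Lemma coef_cross t :
  coefA t * coefB t + coefB t * coefG t + coefG t * coefA t = 0.
Proof. unfold coefA, coefB, coefG. field. apply coef_den. Qed.

(** Reversing [t] inverts the rotation, which exchanges [c] and [c^2]; each estimate for [coefB]
    thus follows from one for [coefG]. *)
Lemma coef_swap t : coefB (- t) = coefG t.
Proof. unfold coefB, coefG. f_equal; [ring|f_equal; ring]. Qed.

Lemma coefA_even t : coefA (- t) = coefA t.
Proof. unfold coefA. f_equal; [ring|f_equal; ring]. Qed.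

Lemma Rabs_div_le x y z : 0 < y -> - (z * y) <= x <= z * y -> Rabs (x / y) <= z.
Proof.
  intros Hy [H1 H2]. apply Rabs_le. split.
  - apply Rmult_le_reg_r with y; [assumption|]. unfold Rdiv.
    rewrite Rmult_assoc, Rinv_l; lra.
  - apply Rmult_le_reg_r with y; [assumption|]. unfold Rdiv.
    rewrite Rmult_assoc, Rinv_l; lra.
Qed.

Lemma coefA_sqr_bound t : Rabs (coefA t * coefA t - 1) <= 8 * (t * t).
Proof.
  replace (coefA t * coefA t - 1) with
    (- (8 * (t * t) * (1 + t * t)) / ((1 + 3 * (t * t)) * (1 + 3 * (t * t))))
    by (unfold coefA; field; apply coef_den).
  apply Rabs_div_le; [nra|]. split; nra.
Qed.

Lemma coefG_sqr_bound t : Rabs (coefG t * coefG t) <= 8 * (t * t).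
Proof.
  replace (coefG t * coefG t) with
    (4 * (t * t) * ((t - 1) * (t - 1)) / ((1 + 3 * (t * t)) * (1 + 3 * (t * t))))
    by (unfold coefG; field; apply coef_den).
  apply Rabs_div_le; [nra|].
  assert ((t - 1) * (t - 1) <= 2 * ((1 + 3 * (t * t)) * (1 + 3 * (t * t)))) by nra.
  assert (0 <= (t - 1) * (t - 1)) by apply Rle_0_sqr.
  split; nra.
Qed.

Lemma coefB_sqr_bound t : Rabs (coefB t * coefB t) <= 8 * (t * t).
Proof.
  pose proof (coefG_sqr_bound (- t)) as H.
  rewrite <- coef_swap, Ropp_involutive in H. lra.
Qed.

Lemma coefBG_bound t : Rabs (coefB t * coefG t) <= 4 * (t * t).
Proof.
  replace (coefB t * coefG t) with
    (4 * (t * t) * (t * t - 1) / ((1 + 3 * (t * t)) * (1 + 3 * (t * t))))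
    by (unfold coefB, coefG; field; apply coef_den).
  assert (0 <= t * t) by apply Rle_0_sqr.
  apply Rabs_div_le; [nra|]. split; nra.
Qed.

Lemma coefAG_bound t : Rabs (coefA t * coefG t + 2 * t) <= 9 * (t * t).
Proof.
  replace (coefA t * coefG t + 2 * t) with
    ((t * t) * (2 + 14 * t - 2 * (t * t) + 18 * (t * t * t))
      / ((1 + 3 * (t * t)) * (1 + 3 * (t * t))))
    by (unfold coefA, coefG; field; apply coef_den).
  apply Rabs_div_le; [nra|].
  set (D := (1 + 3 * (t * t)) * (1 + 3 * (t * t))).
  assert (HD : D = 1 + 6 * (t * t) + 9 * (t * t * (t * t))) by (unfold D; ring).
  (* These squares give [14 t <= 7 + 7 t^2] and [18 t^3 <= 9 t^2 + 9 t^4]; the constant 9 is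
     [2 + 7]. *)
  assert (0 <= (1 - t) * (1 - t)) by apply Rle_0_sqr.
  assert (0 <= (1 + t) * (1 + t)) by apply Rle_0_sqr.
  assert (0 <= (t * (1 - t)) * (t * (1 - t))) by apply Rle_0_sqr.
  assert (0 <= (t * (1 + t)) * (t * (1 + t))) by apply Rle_0_sqr.
  assert (U : 2 + 14 * t - 2 * (t * t) + 18 * (t * t * t) <= 9 * D) by nra.
  assert (L : - (9 * D) <= 2 + 14 * t - 2 * (t * t) + 18 * (t * t * t)) by nra.
  assert (0 <= t * t) by apply Rle_0_sqr.
  split; nra.
Qed.

Lemma coefAB_bound t : Rabs (coefA t * coefB t - 2 * t) <= 9 * (t * t).
Proof.
  pose proof (coefAG_bound (- t)) as H.
  rewrite <- coef_swap, coefA_even, Ropp_involutive in H.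
  replace (coefA t * coefB t - 2 * t) with (coefA t * coefB t + 2 * - t) by ring.
  lra.
Qed.

(** * Elementary bounds for sine and cosine *)

Lemma sin_sqr_le x : sin x * sin x <= x * x.
Proof.
  assert (H : forall z, 0 <= z -> sin z * sin z <= z * z).
  { intros z Hz. destruct (Req_dec z 0) as [->|Hnz]; [rewrite sin_0; lra|].
    pose proof (sin_lt_x z ltac:(lra)). pose proof (SIN_bound z).
    destruct (Rle_dec 0 (sin z)); [nra|].
    destruct (Rle_dec 1 z); [nra|].
    pose proof (sin_ge_0 z Hz). pose proof PI2_3_2. lra. }
  destruct (Rle_dec 0 x); [apply H; assumption|].
  pose proof (H (- x) ltac:(lra)) as H'. rewrite sin_neg in H'. lra.
Qed.

Lemma cos_quadratic_bound x : Rabs (cos x - 1) <= x * x / 2.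
Proof.
  replace (cos x) with (1 - 2 * sin (x / 2) * sin (x / 2))
    by (rewrite <- cos_2a_sin; f_equal; lra).
  pose proof (sin_sqr_le (x / 2)). apply Rabs_le. nra.
Qed.

(** From [z - z^3 / 6 <= sin z <= z] for [z >= 0]: the restriction to [z <= 2] trades the cubic term
    for the quadratic one that matches the other errors of a step. *)
Lemma sin_linear_bound x : Rabs x <= 2 -> Rabs (sin x - x) <= x * x / 3.
Proof.
  assert (H : forall z, 0 <= z <= 2 -> - (z * z / 3) <= sin z - z <= 0).
  { intros z Hz. pose proof PI2_3_2.
    destruct (sin_bound z 0 ltac:(lra) ltac:(lra)) as [H1 H2].
    unfold sin_approx, sin_term in H1. simpl in H1.
    split.
    - nra.
    - destruct (Req_dec z 0) as [->|Hnz]; [rewrite sin_0; lra|].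
      pose proof (sin_lt_x z ltac:(lra)). lra. }
  intros Hx. apply Rabs_le. destruct (Rle_dec 0 x).
  - rewrite Rabs_right in Hx by lra. pose proof (H x ltac:(lra)). nra.
  - rewrite Rabs_left in Hx by lra. pose proof (H (- x) ltac:(lra)) as H'.
    rewrite sin_neg in H'. nra.
Qed.

Lemma Rabs_le_bounds x y : Rabs x <= y -> - y <= x <= y.
Proof. unfold Rabs; destruct (Rcase_abs x); lra. Qed.

Lemma Rabs_mult_le x y X Y : Rabs x <= X -> Rabs y <= Y -> Rabs (x * y) <= X * Y.
Proof.
  intros. rewrite Rabs_mult. apply Rmult_le_compat; auto using Rabs_pos.
Qed.

Lemma Rabs_plus_le x y X Y : Rabs x <= X -> Rabs y <= Y -> Rabs (x + y) <= X + Y.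
Proof. intros. pose proof (Rabs_triang x y). lra. Qed.

(** [step_p], [step_q], [step_r] are the entries found in [step_map_plane], with the coefficients of
    the rotation of parameter [t]. *)
Definition step_p (t k s p q r : R) : R :=
  let a := coefA t in let b := coefB t in let g := coefG t in
  a * a * p + (b * b + g * g * (k * k)) * (p + r)
  + 2 * (a * b) * (k * k * p + k * s * q) + 2 * (a * g) * (k * k * p)
  + 2 * (b * g) * (k * k * p + k * s * q).
Definition step_q (t k s p q r : R) : R :=
  let a := coefA t in let b := coefB t in let g := coefG t in
  a * a * q + g * g * (k * s) * (p + r)
  + a * b * (k * k * q + k * s * r) + a * g * (k * k * q + k * s * p)
  + b * g * (k * s * p + s * s * q).
Definition step_r (t k s p q r : R) : R :=
  let a := coefA t in let g := coefG t in
  a * a * r + g * g * (s * s) * (p + r) + 2 * (a * g) * (k * s * q).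

Lemma step_trace t k s p q r :
  k * k + s * s = 1 -> step_p t k s p q r + step_r t k s p q r = p + r.
Proof.
  intros H. unfold step_p, step_r; cbv zeta.
  pose proof (coef_sqr t) as E1. pose proof (coef_cross t) as E2.
  set (a := coefA t) in *. set (b := coefB t) in *. set (g := coefG t) in *.
  transitivity ((a * a + b * b + g * g * (k * k + s * s)) * (p + r)
    + 2 * (a * b + b * g + g * a) * (k * k * p + k * s * q)); [ring|].
  rewrite H, E2, Rmult_1_r, E1. ring.
Qed.

(* To first order in [t], a step rotates [(p - 1/2, q)] by the angle [- 4 t k s]. *)
Lemma step_near_rotation t k s p q r :
  k * k + s * s = 1 -> p + r = 1 -> t * t <= 1 ->
  Rabs (p - 1 / 2) <= 3 / 2 -> Rabs q <= 3 / 2 ->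
  let y := - (4 * t * (k * s)) in
  Rabs (step_p t k s p q r - 1 / 2 - (cos y * (p - 1 / 2) - sin y * q)) <= 60 * (t * t) /\
  Rabs (step_q t k s p q r - (sin y * (p - 1 / 2) + cos y * q)) <= 60 * (t * t).
Proof.
  intros Hks Hpr Ht Hp Hq y.
  pose proof (Rle_0_sqr (k + s)) as S1. pose proof (Rle_0_sqr (k - s)) as S2.
  pose proof (Rle_0_sqr k) as S3. pose proof (Rle_0_sqr s) as S4. unfold Rsqr in *.
  assert (Hks2 : Rabs (k * s) <= 1 / 2) by (apply Rabs_le; lra).
  assert (Hk2 : Rabs (k * k) <= 1) by (apply Rabs_le; lra).
  assert (Hsk : Rabs (s * s - k * k) <= 1) by (apply Rabs_le; lra).
  assert (Hp2 : Rabs p <= 2).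
  { replace p with (p - 1 / 2 + 1 / 2) by ring.
    pose proof (Rabs_triang (p - 1 / 2) (1 / 2)).
    rewrite (Rabs_right (1 / 2)) in H by lra. lra. }
  assert (Htt : 0 <= t * t) by apply Rle_0_sqr.
  assert (Ht1 : Rabs t <= 1) by (apply Rabs_le; nra).
  assert (Hy : y * y <= 4 * (t * t)).
  { unfold y. replace (- (4 * t * (k * s)) * - (4 * t * (k * s))) with
      (16 * (t * t) * ((k * s) * (k * s))) by ring.
    assert ((k * s) * (k * s) <= 1 / 4) by (apply Rabs_le_bounds in Hks2; nra). nra. }
  assert (Hy2 : Rabs y <= 2) by (apply Rabs_le; nra).
  pose proof (cos_quadratic_bound y) as Hc.
  pose proof (sin_linear_bound y Hy2) as Hs.
  pose proof (coefA_sqr_bound t) as B1. pose proof (coefB_sqr_bound t) as B2.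
  pose proof (coefG_sqr_bound t) as B3. pose proof (coefBG_bound t) as B4.
  pose proof (coefAG_bound t) as B5. pose proof (coefAB_bound t) as B6.
  pose proof (coef_cross t) as E.
  unfold step_p, step_q; cbv zeta.
  set (a := coefA t) in *. set (b := coefB t) in *. set (g := coefG t) in *.
  split.
  (* Each summand is a quantity of order [t^2] times a bounded factor. The identity [coef_cross]
     eliminates [a * b] here and [a * g] in the second coordinate. *)
  - replace (_ - 1 / 2 - _) with
      ((a * a - 1) * p + b * b + g * g * (k * k) + (a * g + 2 * t) * (-2 * ((k * s) * q))
       + (cos y - 1) * - (p - 1 / 2) + (sin y - y) * q).
    + eapply Rle_trans.
      * repeat first [eassumption | rewrite Rabs_Ropp; eassumption
                     | apply Rabs_plus_le | eapply Rabs_mult_le | apply Rle_refl].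
      (* The bounds add up to [16 + 8 + 8 + 27/2 + 3 + 2] times [t^2], within the 60 allowed. *)
      * replace (Rabs (-2)) with 2 by (rewrite Rabs_left; lra). lra.
    + replace r with (1 - p) by lra.
      replace (a * b) with (- (b * g) - g * a) by lra. unfold y. ring.
  - replace (_ - _) with
      ((a * a - 1) * q + g * g * (k * s) + (b * g) * ((s * s - k * k) * q)
       + (a * b - 2 * t) * ((k * s) * (-2 * (p - 1 / 2)))
       + (sin y - y) * - (p - 1 / 2) + (cos y - 1) * - q).
    + eapply Rle_trans.
      * repeat first [eassumption | rewrite Rabs_Ropp; eassumption
                     | apply Rabs_plus_le | eapply Rabs_mult_le | apply Rle_refl].
      * replace (Rabs (-2)) with 2 by (rewrite Rabs_left; lra). lra.
    + replace r with (1 - p) by lra.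
      replace (a * g) with (- (b * g) - a * b) by lra. unfold y. field.
Qed.

(** * Euclidean norm in the plane and accumulation of errors *)

Lemma norm2_triangle x y x' y' :
  sqrt ((x + x') ^ 2 + (y + y') ^ 2) <= sqrt (x ^ 2 + y ^ 2) + sqrt (x' ^ 2 + y' ^ 2).
Proof.
  pose proof (triangle 0 0 (x + x') (y + y') x y) as H.
  unfold dist_euc, Rsqr in H.
  eapply Rle_trans; [|eapply Rle_trans; [exact H|]]; [|apply Rplus_le_compat];
    apply Req_le; f_equal; ring.
Qed.

Lemma norm2_le_sum x y : sqrt (x ^ 2 + y ^ 2) <= Rabs x + Rabs y.
Proof.
  pose proof (Rabs_pos x). pose proof (Rabs_pos y).
  rewrite <- (sqrt_pow2 (Rabs x + Rabs y)) by lra.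
  apply sqrt_le_1_alt. rewrite <- (pow2_abs x), <- (pow2_abs y). nra.
Qed.

Lemma Rabs_le_norm2 x y : Rabs x <= sqrt (x ^ 2 + y ^ 2).
Proof.
  rewrite <- (sqrt_pow2 (Rabs x)) by apply Rabs_pos.
  apply sqrt_le_1_alt. rewrite pow2_abs. nra.
Qed.

(** The ideal rotation takes the target at angle [x] to the one at [x'] and preserves the old error;
    the deviation from it adds at most 60 + 60, one share per coordinate. *)
Lemma step_distance t k s p q r x E :
  k * k + s * s = 1 -> p + r = 1 -> t * t <= 1 -> E <= 1 ->
  sqrt ((p - 1 / 2 - cos x / 2) ^ 2 + (q - sin x / 2) ^ 2) <= E ->
  let x' := x + - (4 * t * (k * s)) in
  sqrt ((step_p t k s p q r - 1 / 2 - cos x' / 2) ^ 2 + (step_q t k s p q r - sin x' / 2) ^ 2)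
    <= E + 120 * (t * t).
Proof.
  intros Hks Hpr Ht HE1 HE x'. set (y := - (4 * t * (k * s))) in *.
  (* The target has coordinates at most 1/2 and the error is at most 1, which gives the bound 3/2
     that [step_near_rotation] asks for. *)
  assert (Hp : Rabs (p - 1 / 2) <= 3 / 2).
  { pose proof (Rabs_le_norm2 (p - 1 / 2 - cos x / 2) (q - sin x / 2)).
    pose proof (COS_bound x).
    assert (H' : Rabs (p - 1 / 2 - cos x / 2) <= 1) by lra.
    apply Rabs_le_bounds in H'. apply Rabs_le. lra. }
  assert (Hq : Rabs q <= 3 / 2).
  { pose proof (Rabs_le_norm2 (q - sin x / 2) (p - 1 / 2 - cos x / 2)) as H.
    rewrite Rplus_comm in H. pose proof (SIN_bound x).
    assert (H' : Rabs (q - sin x / 2) <= 1) by lra.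
    apply Rabs_le_bounds in H'. apply Rabs_le. lra. }
  destruct (step_near_rotation t k s p q r Hks Hpr Ht Hp Hq) as [F1 F2].
  fold y in F1, F2.
  set (u := p - 1 / 2 - cos x / 2) in *. set (v := q - sin x / 2) in *.
  set (f1 := step_p t k s p q r - 1 / 2 - (cos y * (p - 1 / 2) - sin y * q)) in *.
  set (f2 := step_q t k s p q r - (sin y * (p - 1 / 2) + cos y * q)) in *.
  replace (step_p t k s p q r - 1 / 2 - cos x' / 2) with ((cos y * u - sin y * v) + f1)
    by (unfold f1, u, v, x'; rewrite cos_plus; field).
  replace (step_q t k s p q r - sin x' / 2) with ((sin y * u + cos y * v) + f2)
    by (unfold f2, u, v, x'; rewrite sin_plus; field).
  eapply Rle_trans; [apply norm2_triangle|]. apply Rplus_le_compat.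
  - replace ((cos y * u - sin y * v) ^ 2 + (sin y * u + cos y * v) ^ 2) with (u ^ 2 + v ^ 2);
      [exact HE|].
    pose proof (sin2_cos2 y) as H. unfold Rsqr in H.
    transitivity ((sin y * sin y + cos y * cos y) * (u ^ 2 + v ^ 2)); [rewrite H|]; ring.
  - pose proof (norm2_le_sum f1 f2). lra.
Qed.

(** * The protocol *)

(** [n] steps consume [n] copies of each state; the one extra copy of [psi1], passed through by
    [mid], is the initial state. *)
Fixpoint protocol (d : nat) (t : R) (n : nat) : list Mat :=
  match n with
  | O => [mid]
  | S m => step_kraus d (d ^ S m) (d ^ m) (coefA t) (coefB t) (coefG t) (protocol d t m)
  end.

Lemma protocol_TP d t n : kraus_TP (d ^ S n * d ^ n) d (protocol d t n).
Proof.
  induction n as [|n IH].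
  - apply kraus_TP_Lsum. intros i j Hi Hj. simpl in Hi, Hj. simpl protocol. simpl Lsum.
    rewrite (Csum_ext d _ (fun o => Cmul (mid o i) (mid o j)))
      by (intros; rewrite Cconj_mid; reflexivity).
    rewrite (Csum_mid_r d i (fun o => mid o j)) by lia. ring.
  - apply step_kraus_TP; [apply coef_sqr|apply coef_cross|exact IH].
Qed.

(** The start [e1] is the point of angle 0. The bound on [n] keeps every intermediate error at most
    1, as [step_distance] demands. *)
Lemma protocol_state d t n e1 e2 k s :
  orthonormal2 d e1 e2 -> k * k + s * s = 1 ->
  120 * (t * t) * INR n <= 1 ->
  let w := fun i => Cadd (Cmul (RtoC k) (e1 i)) (Cmul (RtoC s) (e2 i)) in
  let x := - (4 * t * (k * s)) * INR n in
  exists p q r,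
    meq d d (kraus_apply (d ^ S n * d ^ n) (protocol d t n) (proj (copies d (S n) n e1 w)))
      (plane_op e1 e2 p q r) /\
    p + r = 1 /\
    sqrt ((p - 1 / 2 - cos x / 2) ^ 2 + (q - sin x / 2) ^ 2) <= 120 * (t * t) * INR n.
Proof.
  intros Ho Hks Hn w. destruct Ho as (H1 & H2 & H3) eqn:E; clear E.
  assert (Hw : unit_vec d w).
  { assert (H4 : inner d e2 e1 = C0) by (rewrite <- inner_conj, H3; apply Cconj_0).
    unfold unit_vec in *.
    assert (I1 : inner d w e1 = RtoC k)
      by (rewrite <- inner_conj; unfold w; rewrite inner_linear_r, H1, H3;
          rewrite Cconj_add, !Cconj_mul, !Cconj_RtoC, Cconj_0; apply C_eq; simpl; ring).
    assert (I2 : inner d w e2 = RtoC s)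
      by (rewrite <- inner_conj; unfold w; rewrite inner_linear_r, H2, H4;
          rewrite Cconj_add, !Cconj_mul, !Cconj_RtoC, Cconj_0; apply C_eq; simpl; ring).
    unfold w at 2. rewrite inner_linear_r, I1, I2, <- !RtoC_mul, <- RtoC_add, Hks.
    reflexivity. }
  induction n as [|n IH].
  - intros x. exists 1, 0, 0. split; [|split].
    + intros i j Hi Hj. rewrite kraus_apply_proj. simpl protocol. simpl Lsum.
      assert (E : forall i, (i < d)%nat ->
        mapp (d ^ 1 * d ^ 0) mid (copies d 1 0 e1 w) i = e1 i).
      { intros i' Hi'. unfold mapp.
        rewrite (Csum_mid_l _ i' (copies d 1 0 e1 w)) by (simpl; lia).
        unfold copies. simpl. unfold vtens. simpl Nat.pow. rewrite !Nat.div_1_r. ring. }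
      unfold proj at 1. rewrite !E by assumption.
      unfold plane_op, proj. apply C_eq; simpl; ring.
    + ring.
    + unfold x; simpl. rewrite !Rmult_0_r, cos_0, sin_0.
      replace (_ + _) with 0 by field. rewrite sqrt_0. lra.
  - rewrite S_INR in Hn. intros x.
    assert (Ht0 : 0 <= t * t) by apply Rle_0_sqr. pose proof (pos_INR n) as Hn0.
    assert (Htn : 0 <= t * t * INR n) by (apply Rmult_le_pos; assumption).
    assert (Hn' : 120 * (t * t) * INR n <= 1) by lra.
    destruct (IH Hn') as (p & q & r & Hm & Hpr & Hd).
    exists (step_p t k s p q r), (step_q t k s p q r), (step_r t k s p q r).
    split; [|split].
    + intros i j Hi Hj.
      change (protocol d t (S n)) with
        (step_kraus d (d ^ S n) (d ^ n) (coefA t) (coefB t) (coefG t) (protocol d t n)).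
      rewrite (step_kraus_apply d n _ _ _ _ e1 w H1 Hw i j Hi Hj).
      rewrite (step_map_ext _ _ _ _ _ _ _ _ Hm i j Hi Hj).
      apply (step_map_plane d _ _ _ e1 e2 k s p q r Ho i j Hi Hj).
    + rewrite step_trace; assumption.
    + assert (Ht1 : t * t <= 1) by lra.
      pose proof (step_distance t k s p q r _ _ Hks Hpr Ht1 Hn' Hd) as H.
      cbv zeta in H.
      replace x with (- (4 * t * (k * s)) * INR n + - (4 * t * (k * s)))
        by (unfold x; rewrite S_INR; ring).
      rewrite S_INR.
      replace (120 * (t * t) * (INR n + 1)) with (120 * (t * t) * INR n + 120 * (t * t)) by ring.
      exact H.
Qed.

(** * The geometry of the two states *)

(** Equality of projectors expresses equality up to phase, which allows [psi2] to be replaced by its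
    phase multiple in all copies at once. *)
Lemma proj_vpow d n u w :
  (forall i j, proj u i j = proj w i j) ->
  forall i j, proj (vpow d n u) i j = proj (vpow d n w) i j.
Proof.
  intros H; induction n as [|n IH]; intros i j; [reflexivity|].
  simpl. unfold proj in *. unfold vtens. rewrite !Cconj_mul.
  specialize (H (i / d ^ n) (j / d ^ n))%nat.
  specialize (IH (i mod d ^ n) (j mod d ^ n))%nat.
  match goal with |- Cmul (Cmul ?a ?b) (Cmul ?c ?e) = Cmul (Cmul ?a' ?b') (Cmul ?c' ?e') =>
    transitivity (Cmul (Cmul a c) (Cmul b e)); [ring|];
    transitivity (Cmul (Cmul a' c') (Cmul b' e')); [|ring] end.
  rewrite H, IH. reflexivity.
Qed.

Lemma proj_copies d n1 n2 psi u w :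
  (forall i j, proj u i j = proj w i j) ->
  forall i j, proj (copies d n1 n2 psi u) i j = proj (copies d n1 n2 psi w) i j.
Proof.
  intros H i j. pose proof (proj_vpow d n2 u w H (i mod d ^ n2) (j mod d ^ n2))%nat as E.
  unfold copies, proj in *. unfold vtens. rewrite !Cconj_mul.
  match goal with |- Cmul (Cmul ?a ?b) (Cmul ?c ?e) = Cmul (Cmul ?a' ?b') (Cmul ?c' ?e') =>
    transitivity (Cmul (Cmul a c) (Cmul b e)); [ring|];
    transitivity (Cmul (Cmul a' c') (Cmul b' e')); [|ring] end.
  rewrite E. reflexivity.
Qed.

Lemma kraus_apply_ext n Ks rho rho' :
  (forall i j, rho i j = rho' i j) ->
  forall i j, kraus_apply n Ks rho i j = kraus_apply n Ks rho' i j.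
Proof.
  intros H i j; induction Ks as [|M Ks IH]; [reflexivity|].
  simpl. unfold madd. fold (kraus_apply n Ks rho) (kraus_apply n Ks rho'). rewrite IH. f_equal.
  unfold mmul. apply Csum_ext; intros l _. f_equal. apply Csum_ext; intros m _.
  rewrite H. reflexivity.
Qed.

Lemma Cmod_conj x : Cmod (Cconj x) = Cmod x.
Proof. unfold Cmod; f_equal; simpl; ring. Qed.

Lemma Cmul_conj_self x : Cmul x (Cconj x) = RtoC (Cmod x * Cmod x).
Proof.
  unfold Cmod. rewrite sqrt_sqrt; [apply C_eq; simpl; ring|].
  apply Rplus_le_le_0_compat; apply Rle_0_sqr.
Qed.

(** Gram-Schmidt: the phase makes the overlap with [psi1] equal to [cos Delta > 0], and [e2] is the
    normalised remainder of the rephased [psi2]. *)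
Lemma states_plane d Delta psi1 psi2 :
  unit_vec d psi1 -> unit_vec d psi2 ->
  acos (Cmod (inner d psi1 psi2)) = Delta -> Delta <> 0 -> Delta <> PI / 2 ->
  0 < cos Delta /\ 0 < sin Delta /\
  Cmul (phase d psi1 psi2) (Cconj (phase d psi1 psi2)) = C1 /\
  exists e2, orthonormal2 d psi1 e2 /\
    forall i, Cmul (phase d psi1 psi2) (psi2 i) =
      Cadd (Cmul (RtoC (cos Delta)) (psi1 i)) (Cmul (RtoC (sin Delta)) (e2 i)).
Proof.
  intros H1 H2 HD HD0 HD2. unfold unit_vec in H1, H2.
  set (m := Cmod (inner d psi1 psi2)) in *.
  assert (m0 : 0 <= m) by apply sqrt_pos.
  (* [acos] is 0 at every argument from 1 on, so [Delta <> 0] yields this without the Cauchy-Schwarz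
     inequality. *)
  assert (m1 : m < 1).
  { apply Rnot_le_lt. intros Hm. apply HD0. rewrite <- HD. unfold acos.
    destruct (Rle_dec m (-1)); [lra|]. destruct (Rle_dec 1 m); [reflexivity|lra]. }
  assert (mn0 : m <> 0) by (intros E; apply HD2; rewrite <- HD, E; apply acos_0).
  assert (Hc : cos Delta = m) by (rewrite <- HD; apply cos_acos; lra).
  assert (Hcs : sin Delta * sin Delta + cos Delta * cos Delta = 1) by apply sin2_cos2.
  assert (Hs : 0 < sin Delta).
  { pose proof (acos_bound m) as Hb. rewrite HD in Hb.
    pose proof (sin_ge_0 Delta (proj1 Hb) (proj2 Hb)).
    destruct (Req_dec (sin Delta) 0) as [E|E]; [rewrite E, Hc in Hcs; nra|lra]. }
  split; [lra|]. split; [exact Hs|].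
  set (ph := phase d psi1 psi2).
  assert (Em : Cmod (inner d psi2 psi1) = m) by (rewrite <- inner_conj; apply Cmod_conj).
  assert (Eph : ph = Cmul (RtoC (/ m)) (inner d psi2 psi1))
    by (unfold ph, phase; rewrite Em; apply Cscale_RtoC).
  assert (Einn : Cmul ph (inner d psi1 psi2) = RtoC m).
  { rewrite Eph, <- (inner_conj d psi2 psi1).
    transitivity (Cmul (RtoC (/ m)) (Cmul (inner d psi2 psi1) (Cconj (inner d psi2 psi1))));
      [ring|].
    rewrite Cmul_conj_self, Em, <- RtoC_mul. f_equal. field. assumption. }
  assert (Eph2 : Cmul ph (Cconj ph) = C1).
  { rewrite Eph, Cconj_mul, Cconj_RtoC.
    transitivity (Cmul (RtoC (/ m * / m))
      (Cmul (inner d psi2 psi1) (Cconj (inner d psi2 psi1)))); [rewrite RtoC_mul; ring|].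
    rewrite Cmul_conj_self, Em, <- RtoC_mul.
    replace (/ m * / m * (m * m)) with 1 by (field; assumption). reflexivity. }
  split; [exact Eph2|].
  set (k := cos Delta) in *. set (s := sin Delta) in *.
  set (e2 := fun i => Cadd (Cmul (Cmul (RtoC (/ s)) ph) (psi2 i))
                           (Cmul (RtoC (- (k / s))) (psi1 i))).
  assert (I12 : inner d psi1 e2 = C0).
  { unfold e2. rewrite inner_linear_r, H1.
    transitivity (Cadd (Cmul (RtoC (/ s)) (Cmul ph (inner d psi1 psi2))) (RtoC (- (k / s))));
      [ring|].
    rewrite Einn, Hc, <- RtoC_mul, <- RtoC_add.
    replace (/ s * m + - (m / s)) with 0 by (field; lra). reflexivity. }
  exists e2. split; [split; [exact H1|split; [|exact I12]]|].
  - unfold unit_vec. unfold e2 at 2. rewrite inner_linear_r.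
    rewrite <- (inner_conj d psi1 e2), I12, Cconj_0.
    rewrite <- (inner_conj d psi2 e2). unfold e2. rewrite inner_linear_r, H2.
    rewrite Cconj_add, !Cconj_mul, !Cconj_RtoC.
    transitivity (Cadd (Cmul (RtoC (/ s * / s)) (Cmul ph (Cconj ph)))
      (Cmul (RtoC (/ s * - (k / s))) (Cmul ph (Cconj (inner d psi2 psi1))))).
    { rewrite !RtoC_mul. replace (Cconj C1) with C1 by (apply C_eq; simpl; ring). ring. }
    rewrite (inner_conj d psi2 psi1), Einn, Eph2, <- Hc.
    apply C_eq; simpl; [|ring].
    transitivity ((1 - k * k) / (s * s)); [field; lra|].
    replace (1 - k * k) with (s * s) by lra. field. lra.
  - intros i. unfold e2.
    transitivity (Cadd (Cmul (RtoC (k + s * - (k / s))) (psi1 i))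
                       (Cmul (RtoC (s * / s)) (Cmul ph (psi2 i)))).
    + replace (k + s * - (k / s)) with 0 by (field; lra).
      rewrite Rinv_r by lra. apply C_eq; simpl; ring.
    + rewrite RtoC_add, !RtoC_mul. ring.
Qed.

(** By the addition formula [psi(chi)] is [cos chi] times [psi1] plus [sin chi] times [e2]; doubling
    the angle exhibits its projector as a point of the Bloch circle. *)
Lemma psi_chi_plane d Delta chi psi1 psi2 e2 :
  sin Delta <> 0 ->
  (forall i, Cmul (phase d psi1 psi2) (psi2 i) =
      Cadd (Cmul (RtoC (cos Delta)) (psi1 i)) (Cmul (RtoC (sin Delta)) (e2 i))) ->
  meq d d (proj (psi_chi d Delta chi psi1 psi2))
    (plane_op psi1 e2 (1 / 2 + cos (2 * chi) / 2) (sin (2 * chi) / 2)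
                      (1 / 2 - cos (2 * chi) / 2)).
Proof.
  intros Hs Hph i j _ _.
  assert (E : forall i, psi_chi d Delta chi psi1 psi2 i =
     Cadd (Cmul (RtoC (cos chi)) (psi1 i)) (Cmul (RtoC (sin chi)) (e2 i))).
  { intros l. unfold psi_chi. rewrite !Cscale_RtoC.
    transitivity (Cadd (Cmul (RtoC (/ sin Delta * sin (Delta - chi))) (psi1 l))
      (Cmul (RtoC (/ sin Delta * sin chi)) (Cmul (phase d psi1 psi2) (psi2 l)))).
    { rewrite !RtoC_mul. ring. }
    rewrite Hph.
    replace (cos chi) with (/ sin Delta * sin (Delta - chi) + / sin Delta * sin chi * cos Delta)
      by (rewrite sin_minus; field; assumption).
    replace (RtoC (sin chi)) with (RtoC (/ sin Delta * sin chi * sin Delta))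
      by (f_equal; field; assumption).
    rewrite RtoC_add, !RtoC_mul. ring. }
  pose proof (sin2_cos2 chi) as H. unfold Rsqr in H.
  replace (1 / 2 + cos (2 * chi) / 2) with (cos chi * cos chi)
    by (rewrite cos_2a; lra).
  replace (1 / 2 - cos (2 * chi) / 2) with (sin chi * sin chi)
    by (rewrite cos_2a; lra).
  replace (sin (2 * chi) / 2) with (cos chi * sin chi) by (rewrite sin_2a; lra).
  unfold plane_op, proj. rewrite !E, !Cconj_add, !Cconj_mul, !Cconj_RtoC, !RtoC_mul. ring.
Qed.

(** The square root measures how far the aimed angle [x] misses [2 chi], the other summand the
    accumulated step errors. Kept apart, they cover both an exact aim and the trivial run with no
    step. *)
Lemma protocol_output d Delta chi psi1 psi2 t n delta :
  unit_vec d psi1 -> unit_vec d psi2 ->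
  acos (Cmod (inner d psi1 psi2)) = Delta -> Delta <> 0 -> Delta <> PI / 2 ->
  120 * (t * t) * INR n <= 1 ->
  (let x := - (2 * t * sin (2 * Delta)) * INR n in
   sqrt ((cos x / 2 - cos (2 * chi) / 2) ^ 2 + (sin x / 2 - sin (2 * chi) / 2) ^ 2)
     + 120 * (t * t) * INR n <= delta) ->
  trace_dist_le d
    (kraus_apply (d ^ S n * d ^ n) (protocol d t n) (proj (copies d (S n) n psi1 psi2)))
    (proj (psi_chi d Delta chi psi1 psi2)) delta.
Proof.
  intros H1 H2 HD HD0 HD2 Hn Hx.
  destruct (states_plane d Delta psi1 psi2 H1 H2 HD HD0 HD2) as (Hc & Hs & Hu & e2 & Ho & Hph).
  set (w := fun i => Cadd (Cmul (RtoC (cos Delta)) (psi1 i)) (Cmul (RtoC (sin Delta)) (e2 i))).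
  assert (Hpw : forall i j, proj psi2 i j = proj w i j).
  { intros i j. unfold proj, w. rewrite <- !Hph, Cconj_mul.
    transitivity (Cmul (Cmul (phase d psi1 psi2) (Cconj (phase d psi1 psi2)))
                       (Cmul (psi2 i) (Cconj (psi2 j)))); [rewrite Hu|]; ring. }
  destruct (protocol_state d t n psi1 e2 (cos Delta) (sin Delta) Ho) as (p & q & r & Hm & Hpr & Hd).
  { pose proof (sin2_cos2 Delta) as H. unfold Rsqr in H. lra. }
  { exact Hn. }
  apply (plane_trace_dist d psi1 e2 _ _ p q r (1 / 2 + cos (2 * chi) / 2) (sin (2 * chi) / 2)
           (1 / 2 - cos (2 * chi) / 2)).
  - exact Ho.
  - intros i j Hi Hj. rewrite <- (Hm i j Hi Hj). apply kraus_apply_ext.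
    apply proj_copies. exact Hpw.
  - apply psi_chi_plane; [lra|exact Hph].
  - lra.
  - eapply Rle_trans; [|exact Hx]. cbv zeta.
    replace (- (2 * t * sin (2 * Delta)) * INR n) with
      (- (4 * t * (cos Delta * sin Delta)) * INR n) by (rewrite sin_2a; ring).
    set (x := - (4 * t * (cos Delta * sin Delta)) * INR n) in *.
    replace (p - (1 / 2 + cos (2 * chi) / 2)) with
      ((cos x / 2 - cos (2 * chi) / 2) + (p - 1 / 2 - cos x / 2)) by ring.
    replace (q - sin (2 * chi) / 2) with
      ((sin x / 2 - sin (2 * chi) / 2) + (q - sin x / 2)) by ring.
    eapply Rle_trans; [apply norm2_triangle|]. apply Rplus_le_compat_l. exact Hd.
Qed.

(** * Choice of the number of steps *)

Lemma nat_ceiling x : 0 <= x -> exists n, x < INR n <= x + 1.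
Proof.
  intros Hx. destruct (archimed x) as [H1 H2].
  assert (H0 : (0 <= up x)%Z) by (apply le_IZR; lra).
  exists (Z.to_nat (up x)). rewrite INR_IZR_INZ, Z2Nat.id by assumption. lra.
Qed.

Theorem mainTheorem13 :
  exists K : R, 0 < K /\
  forall (d : nat) (Delta chi delta : R),
    Delta <> 0 -> Delta <> PI / 2 -> 0 < delta ->
    exists (n1 n2 : nat) (Ks : list Mat),
      INR n1 <= K * (1 + chi ^ 2 / (delta * (sin (2 * Delta)) ^ 2)) /\
      INR n2 <= K * (1 + chi ^ 2 / (delta * (sin (2 * Delta)) ^ 2)) /\
      kraus_TP (d ^ n1 * d ^ n2) d Ks /\
      forall psi1 psi2 : Vec,
        unit_vec d psi1 -> unit_vec d psi2 ->
        acos (Cmod (inner d psi1 psi2)) = Delta ->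
        trace_dist_le d
          (kraus_apply (d ^ n1 * d ^ n2) Ks (proj (copies d n1 n2 psi1 psi2)))
          (proj (psi_chi d Delta chi psi1 psi2))
          delta.
Proof.
  (* The step count is at most [120 X + 1], where [X] is the quotient in the bound, and [psi1] needs
     one copy more. *)
  exists 122. split; [lra|]. intros d Delta chi delta HD0 HD2 Hdelta.
  set (S2 := sin (2 * Delta)).
  assert (Hchi : 0 <= chi ^ 2) by apply pow2_ge_0.
  destruct (Req_dec S2 0) as [HS|HS]; [|destruct (Rle_dec 1 delta) as [Hd1|Hd1]].
  (* No pair of states has such an angle [Delta], so any channel will do; the quotient in the bound
     is 0 because division by zero gives 0. *)
  - exists 1%nat, 0%nat, (protocol d 0 0).
    replace (chi ^ 2 / (delta * S2 ^ 2)) with 0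
      by (rewrite HS; unfold Rdiv; replace (delta * 0 ^ 2) with 0 by ring;
          rewrite Rinv_0; ring).
    split; [simpl INR; lra|]. split; [simpl INR; lra|]. split; [apply protocol_TP|].
    intros psi1 psi2 H1 H2 HD. exfalso.
    destruct (states_plane d Delta psi1 psi2 H1 H2 HD HD0 HD2) as (Hc & Hs & _).
    unfold S2 in HS. rewrite sin_2a in HS.
    pose proof (Rmult_lt_0_compat _ _ Hs Hc). lra.
  (* Trace distance between states is at most 1, so [psi1] itself is good enough. For the remaining
     [delta < 1], a total error below [delta] also satisfies the bound 1 required by
     [protocol_output]. *)
  - assert (HX : 0 <= chi ^ 2 / (delta * S2 ^ 2)).
    { apply Rmult_le_pos; [assumption|]. left. apply Rinv_0_lt_compat.
      apply Rmult_lt_0_compat; [assumption|]. rewrite <- Rsqr_pow2; apply Rsqr_pos_lt; assumption. }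
    exists 1%nat, 0%nat, (protocol d 0 0).
    split; [simpl INR; lra|]. split; [simpl INR; lra|]. split; [apply protocol_TP|].
    intros psi1 psi2 H1 H2 HD. apply (protocol_output d Delta chi psi1 psi2 0 0); auto.
    + simpl; lra.
    + simpl INR. cbv zeta. rewrite !Rmult_0_r, Rplus_0_r, cos_0, sin_0.
      (* The squared distance from angle 0 to angle [2 chi] is [(1 - cos (2 * chi)) / 2]. *)
      apply Rle_trans with (sqrt 1); [|rewrite sqrt_1; exact Hd1]. apply sqrt_le_1_alt.
      pose proof (sin2_cos2 (2 * chi)) as H. unfold Rsqr in H.
      pose proof (COS_bound (2 * chi)). lra.
  - assert (HS2 : 0 < S2 ^ 2) by (rewrite <- Rsqr_pow2; apply Rsqr_pos_lt; assumption).
    set (X := chi ^ 2 / (delta * S2 ^ 2)).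
    assert (HX : 0 <= X).
    { apply Rmult_le_pos; [assumption|]. left. apply Rinv_0_lt_compat.
      apply Rmult_lt_0_compat; assumption. }
    (* The strict inequality makes [n] positive even for [chi = 0], since the angle is divided by
       [n]. *)
    destruct (nat_ceiling (120 * X)) as (n & Hn1 & Hn2); [lra|].
    exists (S n), n, (protocol d (- chi / (INR n * S2)) n).
    split; [rewrite S_INR; lra|]. split; [lra|]. split; [apply protocol_TP|].
    assert (Hn0 : 0 < INR n) by lra.
    set (t := - chi / (INR n * S2)).
    assert (Ht : 120 * (t * t) * INR n <= delta).
    { replace (120 * (t * t) * INR n) with (120 * X * (delta / INR n))
        by (unfold t, X; field; repeat split; lra).
      apply Rle_trans with (INR n * (delta / INR n)).
      - apply Rmult_le_compat_r; [|lra]. apply Rlt_le, Rdiv_lt_0_compat; assumption.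
      - apply Req_le. field. lra. }
    intros psi1 psi2 H1 H2 HD.
    apply (protocol_output d Delta chi psi1 psi2 t n); auto; [lra|].
    (* The [n] rotations add up to exactly [2 chi], so only the step errors remain. *)
    fold S2. replace (- (2 * t * S2) * INR n) with (2 * chi) by (unfold t; field; lra).
    cbv zeta. rewrite !Rminus_diag.
    replace (0 ^ 2 + 0 ^ 2) with 0 by ring. rewrite sqrt_0. lra.
Qed.
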